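(* Let $d\ge2$, let $E\subset[1,2]$ be nonempty, and let $\beta=\dim_M E$. Let $1\le p,q\le\infty$. (i) If $(1/p,1/q)\notin\mathcal Q(\beta,\beta)$, then $$\sup\{\|M_Ef\|_{L^q(\mathbb R^d)}:\ \|f\|_{L^p(\mathbb R^d)}\le1\}=\infty.\qquad( * )$$ (ii) Let $\theta\in[0,1)$ be such that $\dim_{A,\theta}E=\frac{\dim_M E}{1-\theta}$. Then $( * )$ holds whenever $(1/p,1/q)\notin\mathcal Q\big(\beta,\tfrac{\beta}{1-\theta}\big)$. (iii) If $0\le\beta\le\gamma\le1$ and $E$ is $(\beta,\gamma)$-Assouad regular, then $( * )$ holds whenever $(1/p,1/q)\notin\mathcal Q(\beta,\gamma)$.
   Context: $A_tf(x)=\int f(x-ty)\,d\sigma(y)$, where $\sigma$ is the normalized surface measure on the unit sphere in $\mathbb R^d$, and $M_Ef(x)=\sup_{t\in E}|A_tf(x)|$, which is well defined as a measurable function at least for continuous $f$; the supremum in $( * )$ is understood over continuous $f$. For $E\subset\mathbb R$ and $\delta>0$, $N(E,\delta)$ is the minimal number of compact intervals of length $\delta$ needed to cover $E$. The upper Minkowski dimension $\dim_M E$ is the smallest $\beta$ such that for every $\varepsilon>0$ there is $C(\varepsilon)$ with $N(E,\delta)\le C(\varepsilon)\delta^{-\beta-\varepsilon}$ for all $\delta<1$. The upper Assouad dimension $\dim_A E$ is the smallest $\gamma$ such that there exist $\delta_0>0$ and constants $C_\varepsilon$ (for all $\varepsilon>0$) with $N(E\cap I,\delta)\le C_\varepsilon(\delta/|I|)^{-\gamma-\varepsilon}$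 for all $\delta\in(0,\delta_0)$ and all intervals $I$ of length $|I|\in(\delta,\delta_0)$. For $0\le\theta<1$, $\dim_{A,\theta}E$ (the Assouad spectrum of $E$ at $\theta$) is the smallest number $\gamma(\theta)$ such that there exist $\delta_0>0$ and constants $C_\varepsilon$ (for all $\varepsilon>0$) with $N(E\cap I,\delta)\le C_\varepsilon(\delta/|I|)^{-\gamma(\theta)-\varepsilon}$ for all $\delta\in(0,\delta_0)$ and all intervals $I$ of length $|I|=\delta^\theta$. $E$ is called $(\beta,\gamma)$-Assouad regular if $\dim_M E=\beta$, $\dim_A E=\gamma$ and $\dim_{A,\theta}E=\dim_A E$ for all $\theta$ with $1>\theta>1-\beta/\gamma$. (In particular, if $\dim_M E=\dim_A E$ or $\dim_M E=0$, then $E$ is always Assouad regular; this is also the convention when $\beta=\gamma=0$.) For $0\le\beta\le\gamma\le1$, $\mathcal Q(\beta,\gamma)\subset\mathbb R^2$ is the closed convex hull of the points $Q_1=(0,0)$, $Q_2(\beta)=\big(\tfrac{d-1}{d-1+\beta},\tfrac{d-1}{d-1+\beta}\big)$, $Q_3(\beta)=\big(\tfrac{d-\beta}{d-\beta+1},\tfrac1{d-\beta+1}\big)$, $Q_4(\gamma)=\big(\tfrac{d(d-1)}{d^2+2\gamma-1},\tfrac{d-1}{d^2+2\gamma-1}\big)$. *)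

(* Defs.v *)
From HB Require Import structures.
From mathcomp Require Import all_boot all_order all_algebra.
From mathcomp Require Import interval_inference.
From mathcomp Require Import all_classical all_reals all_analysis.
From mathcomp Require Import measurable_realfun.
Set Implicit Arguments.
Unset Strict Implicit.
Unset Printing Implicit Defensive.
Import Order.TTheory GRing.Theory Num.Theory.
Import numFieldNormedType.Exports.
Local Open Scope classical_set_scope.
Local Open Scope ring_scope.

(* R^n is 'rV[R]_n.  Its sigma-algebra is generated by the coordinates; it is
   the Borel one, as open_measurable_row below shows. *)
Section MeasurableRow.
Context {R : realType} {n : nat}.

Let coord (i : 'I_n) (x : 'rV[R]_n) : R := x ord0 i.

Let row_set0 : g_sigma_preimage coord set0.
Proof. exact: sigma_algebra0. Qed.

Let row_setC A : g_sigma_preimage coord A -> g_sigma_preimage coord (~` A).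
Proof. exact: sigma_algebraC. Qed.

Let row_bigcup (F : (set 'rV[R]_n)^nat) :
  (forall i, g_sigma_preimage coord (F i)) ->
  g_sigma_preimage coord (\bigcup_i (F i)).
Proof. exact: sigma_algebra_bigcup. Qed.

HB.instance Definition _ := @isMeasurable.Build default_measure_display
  'rV[R]_n (g_sigma_preimage coord) row_set0 row_setC row_bigcup.

Lemma measurable_coord (i : 'I_n) :
  measurable_fun [set: 'rV[R]_n] (fun x => x ord0 i).
Proof.
move=> _ Y mY; rewrite setTI; apply: sub_sigma_algebra => /=.
rewrite -bigcup_seq/=; exists i => /=; first by rewrite mem_index_enum.
by exists Y => //; rewrite setTI.
Qed.

Lemma measurable_fun_rowP d (T : measurableType d) (f : T -> 'rV[R]_n) :
  (forall i, measurable_fun [set: T] (fun x => f x ord0 i)) ->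
  measurable_fun [set: T] f.
Proof.
move=> mf _ Y.
rewrite /measurable/=.
suff : g_sigma_preimage coord `<=` [set B | measurable ([set: T] `&` f @^-1` B)].
  exact.
apply: smallest_sub; last first.
  rewrite -bigcup_seq => B [i _ [C mC <-]] /=.
  by rewrite setTI; exact: mf.
split=> /=.
- by rewrite preimage_set0 setI0.
- by move=> A mA; rewrite setTD preimage_setC setTI; apply: measurableC; rewrite -[X in measurable X]setTI.
- move=> F mF; rewrite preimage_bigcup setI_bigcupr.
  exact: bigcupT_measurable.
Qed.

End MeasurableRow.

Section LebesgueCons.
Context {R : realType} {n : nat}.

Definition row_cons (p : measurableTypeR R * 'rV[R]_n) : 'rV[R]_n.+1 :=
  row_mx (const_mx p.1 : 'rV[R]_1) p.2.

Lemma measurable_row_cons : measurable_fun setT row_cons.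
Proof.
apply: measurable_fun_rowP => i; rewrite /row_cons.
under eq_fun => p do rewrite mxE.
case: splitP => j _.
  under eq_fun => p do rewrite mxE.
  exact: measurable_fst.
exact: (measurableT_comp (measurable_coord j) measurable_snd).
Qed.

HB.instance Definition _ := isMeasurableFun.Build _ _ _ _ row_cons
  measurable_row_cons.

Variable mu : {sigma_finite_measure set 'rV[R]_n -> \bar R}.

Definition lebesgue_cons : set 'rV[R]_n.+1 -> \bar R :=
  pushforward (@lebesgue_measure R \x mu)%E row_cons.

Let lebesgue_cons0 : lebesgue_cons set0 = 0%E.
Proof. exact: measure0. Qed.

Let lebesgue_cons_ge0 A : (0 <= lebesgue_cons A)%E.
Proof. exact: measure_ge0. Qed.

Let lebesgue_cons_sigma_additive : semi_sigma_additive lebesgue_cons.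
Proof. exact: measure_semi_sigma_additive. Qed.

HB.instance Definition _ := isMeasure.Build _ _ _ lebesgue_cons
  lebesgue_cons0 lebesgue_cons_ge0 lebesgue_cons_sigma_additive.

Let lebesgue_cons_sigma_finite : sigma_finite setT lebesgue_cons.
Proof.
have [F FT Ffin] : sigma_finite setT (@lebesgue_measure R \x mu)%E.
  have /sigma_finiteP[F [TF ndF Foo]] := sigma_finiteT (@lebesgue_measure R).
  have /sigma_finiteP[G [TG ndG Goo]] := sigma_finiteT mu.
  exists (fun k => F k `*` G k).
    rewrite -setXTT TF TG predeqE => -[x y]; split => [[/= [i _ Fx] [j _ Gy]]|].
      exists (maxn i j) => //; split.
        by move: x Fx; exact/subsetPset/ndF/leq_maxl.
      by move: y Gy; exact/subsetPset/ndG/leq_maxr.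
    by move=> [k _ [/= Fx Gy]]; split; exists k.
  move=> k; have [mF Fk] := Foo k; have [mG Gk] := Goo k.
  split; first exact: measurableX.
  by rewrite product_measure1E// lte_mul_pinfty// ge0_fin_numE.
pose uncons (x : 'rV[R]_n.+1) : measurableTypeR R * 'rV[R]_n :=
  ((x : 'rV_(1 + n)) ord0 (lshift n ord0), rsubmx (x : 'rV_(1 + n))).
have mu_uncons : measurable_fun setT uncons.
  apply/measurable_fun_pairP; split.
    exact: measurable_coord.
  apply: measurable_fun_rowP => i.
  under eq_fun => x do rewrite /= mxE.
  exact: measurable_coord.
have consK : cancel row_cons uncons.
  move=> [a x]; rewrite /uncons /row_cons row_mxKr; congr pair.
  by rewrite row_mxEl mxE.
exists (fun k => uncons @^-1` F k).
  by rewrite -preimage_bigcup -FT preimage_setT.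
move=> k; have [mF Foo] := Ffin k; split.
  by rewrite -[X in measurable X]setTI; exact: mu_uncons.
rewrite /lebesgue_cons /pushforward -comp_preimage.
rewrite (_ : uncons \o row_cons = id)//.
by apply/funext => p /=; rewrite consK.
Qed.

HB.instance Definition _ := Measure_isSigmaFinite.Build _ _ _ lebesgue_cons
  lebesgue_cons_sigma_finite.

End LebesgueCons.

(* n-dimensional Lebesgue measure, as an iterated product; its value on boxes is
   given by lebesgue_row_box. *)
Fixpoint lebesgue_row (R : realType) (n : nat) :
    {sigma_finite_measure set 'rV[R]_n -> \bar R} :=
  if n is m.+1 then lebesgue_cons (lebesgue_row R m) else \d_(0 : 'rV[R]_0).

Lemma measurable_box (R : realType) n (A : 'I_n -> set R) :
  (forall i, measurable (A i)) ->
  measurable [set x : 'rV[R]_n | forall i, A i (x ord0 i)].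
Proof.
move=> mA.
rewrite (_ : mkset _ = \bigcap_(i in [set: 'I_n]) ((fun x : 'rV[R]_n => x ord0 i) @^-1` A i)).
  apply: fin_bigcap_measurable => // i _.
  rewrite -[X in measurable X]setTI; exact: measurable_coord.
by apply/seteqP; split => x /= h i; [move=> _; exact: h|exact: (h i I)].
Qed.

Lemma lebesgue_row_box (R : realType) n (A : 'I_n -> set R) :
  (forall i, measurable (A i)) ->
  lebesgue_row R n [set x | forall i, A i (x ord0 i)] =
  (\prod_(i < n) lebesgue_measure (A i))%E.
Proof.
elim: n A => [|n IH] A mA.
  by rewrite big_ord0 /= diracE mem_set//= => -[].
rewrite big_ord_recl -IH; last by move=> i; exact: mA.
rewrite /= /lebesgue_cons /pushforward -product_measure1E; last 2 first.
- exact: mA.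
- by apply: (@measurable_box R n (fun i => A (lift ord0 i))) => i; exact: mA.
congr product_measure1; apply/seteqP; split => -[x y] /=.
  move=> h; split => /=.
    have := h ord0; rewrite /row_cons mxE.
    case: splitP => [j _|k /= kE]; first by rewrite mxE.
    by rewrite add1n in kE.
  move=> i; have := h (lift ord0 i); rewrite /row_cons mxE.
  case: splitP => [[[|//] j] //=|k /= kE].
  by move: kE; rewrite /bump /= add1n => -[/val_inj ->].
move=> [Ax Ay] i; rewrite /row_cons mxE /=.
case: splitP => [j /= ij|k /= kE].
  by rewrite mxE (_ : i = ord0)//; apply/val_inj; rewrite /= ij ord1.
by rewrite (_ : i = lift ord0 k)//; apply/val_inj; rewrite /= kE.
Qed.

Lemma open_measurable_row (R : realType) n (A : set 'rV[R]_n) : open A -> measurable A.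
Proof.
move=> oA.
pose B (q : 'rV[rat]_n * nat) : set 'rV[R]_n :=
  [set x | forall i, ball (ratr (q.1 ord0 i) : R) (q.2.+1%:R^-1) (x ord0 i)].
have mB q : measurable (B q).
  have := @measurable_box R n (fun i => ball (ratr (q.1 ord0 i) : R) (q.2.+1%:R^-1)).
  apply.
  by move=> i; apply: open_measurable; apply: ball_open; rewrite invr_gt0.
pose B' k := if @unpickle ('rV[rat]_n * nat)%type k is Some q then
  if `[< B q `<=` A >] then B q else set0 else set0.
rewrite (_ : A = \bigcup_k B' k).
  apply: bigcupT_measurable => k; rewrite /B'.
  case: unpickle => [q|]; last exact: measurable0.
  by case: ifP => // _; exact: measurable0.
apply/seteqP; split => [x Ax|x [k _]]; last first.
  rewrite /B'; case: unpickle => // q; case: ifPn => // /asboolP; exact.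
have /nbhs_ballP[e /= e0 eA] : nbhs x A by apply: open_nbhs_nbhs.
pose k := Num.truncn (2 / e).
have ke : k.+1%:R^-1 < e / 2.
  rewrite invf_plt ?posrE ?divr_gt0// invf_div.
  by have := truncnS_gt (2 / e).
have /choice[q qE] : forall i, exists q : rat, ball (x ord0 i) k.+1%:R^-1 (ratr q).
  move=> i.
  have : x ord0 i - k.+1%:R^-1 < x ord0 i + k.+1%:R^-1.
    by rewrite ltrD2l gt0_cp// invr_gt0.
  move=> /rat_in_itvoo[q]; rewrite in_itv/= => /andP[q1 q2]; exists q.
  by rewrite /ball/= distrC ltr_norml ltrBrDl q1 ltrBlDl.
exists (pickle (\row_i q i, k)) => //; rewrite /B' pickleK ifT.
  by move=> i /=; rewrite mxE; exact: ball_sym.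
apply/asboolP => y By; apply: eA; split=> [|i j]; [exact: e0|rewrite ord1 {i}].
have := By j; rewrite /= mxE => /ball_sym qy.
have xy := ball_triangle (qE j) (ball_sym qy).
by apply: le_ball xy; rewrite (splitr e) lerD// ltW.
Qed.

Section Sphere.
Context {R : realType} {n : nat}.

(* The library norm on 'rV[R]_n is the sup norm (same topology). *)
Definition enorm (x : 'rV[R]_n) : R := Num.sqrt (\sum_i x ord0 i ^+ 2).

Lemma measurable_enorm : measurable_fun setT enorm.
Proof.
have -> : enorm = (fun x => (\sum_i x ord0 i ^+ 2) `^ 2^-1).
  apply/funext => x; rewrite powR12_sqrt// sumr_ge0// => i _.
  exact: sqr_ge0.
apply: (measurableT_comp (measurable_powR 2^-1)).
by apply: measurable_sum => i; apply: measurable_funX; exact: measurable_coord.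
Qed.

Definition direction (x : 'rV[R]_n) : 'rV[R]_n := (enorm x)^-1 *: x.

Lemma measurable_direction : measurable_fun setT direction.
Proof.
apply: measurable_fun_rowP => i; rewrite /direction.
under eq_fun => x do rewrite mxE -powR_inv1 ?sqrtr_ge0//.
apply: measurable_funM; last exact: measurable_coord.
exact: (measurableT_comp (measurable_powR (-1)) measurable_enorm).
Qed.

HB.instance Definition _ := isMeasurableFun.Build _ _ _ _ direction
  measurable_direction.

Definition unit_ball : set 'rV[R]_n := [set x | enorm x <= 1].

Lemma measurable_unit_ball : measurable unit_ball.
Proof.
rewrite (_ : unit_ball = setT `&` enorm @^-1` `]-oo, 1]).
  exact: measurable_enorm.
by rewrite setTI; apply/seteqP; split => x /=; rewrite in_itv.
Qed.

(* n times cone_measure A is the surface area of the part of A lying in the unit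
   sphere: polar coordinates give A the volume of the cone
   { r y : 0 < r <= 1, y \in A, |y| = 1 }.  The origin, where direction is 0, is
   a null set for 0 < n. *)
Definition cone_measure : set 'rV[R]_n -> \bar R :=
  pushforward (mrestr (lebesgue_row R n) measurable_unit_ball) direction.

Let cone_measure0 : cone_measure set0 = 0%E.
Proof. exact: measure0. Qed.

Let cone_measure_ge0 A : (0 <= cone_measure A)%E.
Proof. exact: measure_ge0. Qed.

Let cone_measure_sigma_additive : semi_sigma_additive cone_measure.
Proof. exact: measure_semi_sigma_additive. Qed.

HB.instance Definition _ := isMeasure.Build _ _ _ cone_measure
  cone_measure0 cone_measure_ge0 cone_measure_sigma_additive.

(* The fallback measure taken by mnormalize is never used, since
   0 < |unit_ball| < +oo: see sphere_measureE. *)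
Definition sphere_measure : probability 'rV[R]_n R :=
  mnormalize cone_measure (\d_(0 : 'rV[R]_n)).

End Sphere.

Lemma unit_ball_gt0_lty (R : realType) d : (0 < lebesgue_row R d unit_ball < +oo)%E.
Proof.
apply/andP; split.
  pose r : R := d.+1%:R^-1.
  have r0 : 0 < r by rewrite invr_gt0.
  have : (0 < lebesgue_row R d [set x | forall i : 'I_d, `[0%R, r]%classic (x ord0 i)])%E.
    rewrite (@lebesgue_row_box R d (fun=> `[0, r]%classic))//.
    elim/big_rec : _ => // i x _ x0.
    by rewrite mule_gt0// lebesgue_measure_itv/= lte_fin r0 -EFinB subr0 lte_fin.
  move/lt_le_trans; apply; apply: le_measure; rewrite ?inE.
  - by apply: (@measurable_box R d (fun=> `[0, r]%classic)).
  - exact: measurable_unit_ball.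
  - move=> x /= h; rewrite /unit_ball /= /enorm -[leRHS]sqrtr1 ler_wsqrtr//.
    apply: (@le_trans _ _ (\sum_(i < d) r)).
      apply: ler_sum => i _; have := h i; rewrite /= in_itv/= => /andP[h0 h1].
      rewrite expr2 (le_trans (ler_pM h0 h0 h1 h1))// -[leRHS]mulr1 ler_pM2l//.
      by rewrite invf_le1// ler1n.
    by rewrite sumr_const card_ord -mulr_natl ler_pdivrMr// mul1r ler_nat.
apply: (@le_lt_trans _ _ (lebesgue_row R d [set x | forall i : 'I_d, `[-1, 1]%classic (x ord0 i)])).
  apply: le_measure; rewrite ?inE.
  - exact: measurable_unit_ball.
  - by apply: (@measurable_box R d (fun=> `[-1, 1]%classic)).
  - move=> x /= h i; rewrite in_itv/= -ler_norml.
    apply: le_trans h; rewrite -sqrtr_sqr /enorm ler_wsqrtr//.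
    rewrite (bigD1 i)//= lerDl sumr_ge0// => j _; exact: sqr_ge0.
rewrite (@lebesgue_row_box R d (fun=> `[-1, 1]%classic))//.
elim/big_rec : _ => // [|i x _ x0]; first by rewrite ltry.
rewrite lte_mul_pinfty// lebesgue_measure_itv/=; case: ifP => // _.
Qed.

Lemma sphere_measureE (R : realType) d (A : set 'rV[R]_d) :
  sphere_measure A = (lebesgue_row R d (direction @^-1` A `&` unit_ball) *
    (fine (lebesgue_row R d unit_ball))^-1%:E)%E.
Proof.
rewrite /sphere_measure /= /mnormalize /=.
have -> : cone_measure [set: 'rV[R]_d] = lebesgue_row R d unit_ball.
  by rewrite /cone_measure /pushforward /mrestr preimage_setT setTI.
have /andP[b0 boo] := unit_ball_gt0_lty R d.
by rewrite gt_eqF// lt_eqF.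
Qed.

Lemma sphere_measure_sphere (R : realType) d : (0 < d)%N ->
  sphere_measure [set x : 'rV[R]_d | enorm x = 1] = 1%E.
Proof.
move=> d0.
have mS : measurable [set x : 'rV[R]_d | enorm x = 1].
  by rewrite (_ : mkset _ = setT `&` enorm @^-1` [set 1]) ?setTI//; rewrite -[X in measurable X]setTI; apply: measurable_enorm.
rewrite sphere_measureE.
have /andP[b0 boo] := unit_ball_gt0_lty R d.
rewrite (_ : _ `&` _ = unit_ball `\` [set x | forall i, [set 0%R] (x ord0 i)]).
  rewrite measureD//; last 2 first.
  - exact: measurable_unit_ball.
  - exact: (@measurable_box R d (fun=> [set 0])).
  rewrite [X in (_ - X)%E](_ : _ = 0%E); last first.
    apply/eqP; rewrite eq_le measure_ge0 andbT.
    apply: (@le_trans _ _ (lebesgue_row R d [set x | forall i, [set 0%R] (x ord0 i)])).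
      apply: le_measure; rewrite ?inE //.
      - apply: measurableI; first exact: measurable_unit_ball.
        exact: (@measurable_box R d (fun=> [set 0])).
      - exact: (@measurable_box R d (fun=> [set 0])).
    rewrite (@lebesgue_row_box R d (fun=> [set 0]))//.
    by case: d d0 {mS b0 boo} => // d _; rewrite big_ord_recl lebesgue_measure_set1 mul0e.
  rewrite sube0 -[X in (X * _)%E]fineK ?ge0_fin_numE//.
  by rewrite -EFinM divff// fine_eq0 ?gt_eqF// ge0_fin_numE.
have eP (x : 'rV[R]_d) : (enorm x == 0) = [forall i, x ord0 i == 0].
  rewrite /enorm sqrtr_eq0 le_eqVlt ltNge sumr_ge0 ?orbF => [|i _]; last exact: sqr_ge0.
  rewrite psumr_eq0 => [|i _]; last exact: sqr_ge0.
  apply/allP/forallP => [h i|h i _]; last by rewrite /= sqrf_eq0.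
  by have := h i (mem_index_enum _); rewrite /= sqrf_eq0.
have eZ (a : R) (x : 'rV[R]_d) : enorm (a *: x) = `|a| * enorm x.
  rewrite /enorm -sqrtr_sqr -sqrtrM ?sqr_ge0// mulr_sumr; congr Num.sqrt.
  by apply: eq_bigr => i _; rewrite mxE exprMn.
apply/seteqP; split => x /=.
  rewrite /direction eZ => -[h xB]; split => // x0.
  have /eqP e0 : enorm x == 0 by rewrite eP; apply/forallP => i; apply/eqP/x0.
  by move: h; rewrite e0 mulr0 => /esym/eqP; rewrite oner_eq0.
move=> [xB x0]; split => //; rewrite /direction eZ ger0_norm ?invr_ge0 ?sqrtr_ge0//.
rewrite mulVf// eP; apply/negP => /forallP h; apply: x0 => i; exact/eqP.
Qed.

Section MaximalFunction.
Context {R : realType} {d : nat}.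
Local Open Scope ereal_scope.

Definition spherical_mean (t : R) (f : 'rV[R]_d -> R) (x : 'rV[R]_d) : \bar R :=
  \int[@sphere_measure R d]_y (f (x - t *: y)%R)%:E.

Definition spherical_maximal (E : set R) (f : 'rV[R]_d -> R)
    (x : 'rV[R]_d) : \bar R :=
  ereal_sup [set `|spherical_mean t f x| | t in E].

End MaximalFunction.

Definition spherical_maximal_norm (R : realType) (d : nat) (E : set R)
    (p q : \bar R) : \bar R :=
  ereal_sup [set 'N[lebesgue_row R d]_q[spherical_maximal E f] |
    f in [set f : 'rV[R]_d -> R |
      continuous f /\ 'N[lebesgue_row R d]_p[EFin \o f] <= 1]]%E.

Section Dimensions.
Context {R : realType}.
Implicit Types (E : set R) (delta theta beta gamma : R).

(* +oo when E is not covered by finitely many intervals. *)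
Definition covering_number E delta : \bar R :=
  ereal_inf [set n%:R%:E | n in [set n : nat | exists a : 'I_n -> R,
    E `<=` \bigcup_i `[a i, a i + delta]%classic]].

(* In the three dimensions below the infimum over the admissible exponents is a
   minimum when E is nonempty and bounded.  The sets are closed thanks to the loss
   eps; for the last two, whose threshold delta0 comes before eps, a change of
   delta0 only costs a change of C, since E is bounded. *)
Definition upper_minkowski_dim E : R :=
  inf [set beta | forall eps, 0 < eps -> exists C : R,
    forall delta, 0 < delta < 1 ->
      (covering_number E delta <= (C * delta `^ (- beta - eps))%:E)%E].

(* With ca, cb ranging over bool, Interval (BSide ca a) (BSide cb b) ranges over
   the open, closed and half-open intervals with endpoints a and b. *)
Definition upper_assouad_dim E : R :=
  inf [set gamma | exists2 delta0 : R, 0 < delta0 &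
    forall eps, 0 < eps -> exists C : R,
    forall (delta a b : R) (ca cb : bool),
      0 < delta < delta0 -> delta < b - a < delta0 ->
      (covering_number (E `&` [set` Interval (BSide ca a) (BSide cb b)]) delta
        <= (C * (delta / (b - a)) `^ (- gamma - eps))%:E)%E].

Definition assouad_spectrum theta E : R :=
  inf [set gamma | exists2 delta0 : R, 0 < delta0 &
    forall eps, 0 < eps -> exists C : R,
    forall (delta a b : R) (ca cb : bool),
      0 < delta < delta0 -> b - a = delta `^ theta ->
      (covering_number (E `&` [set` Interval (BSide ca a) (BSide cb b)]) delta
        <= (C * (delta / (b - a)) `^ (- gamma - eps))%:E)%E].

(* If gamma = 0 then beta / gamma = 0 in MathComp, so the last condition is vacuous,
   as it is when beta = 0. *)
Definition assouad_regular beta gamma E : Prop :=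
  [/\ upper_minkowski_dim E = beta,
      upper_assouad_dim E = gamma
    & forall theta, 1 - beta / gamma < theta < 1 ->
        assouad_spectrum theta E = upper_assouad_dim E].

End Dimensions.

(* The closed convex hull Q(beta, gamma) in the plane. *)
Definition quadrangle (R : realType) (d : nat) (beta gamma : R) :
    set (R^o * R^o) :=
  let D : R := d%:R in
  let Q1 := (0, 0) in
  let Q2 := ((D - 1) / (D - 1 + beta), (D - 1) / (D - 1 + beta)) in
  let Q3 := ((D - beta) / (D - beta + 1), (D - beta + 1)^-1) in
  let Q4 := (D * (D - 1) / (D ^+ 2 + 2 * gamma - 1),
             (D - 1) / (D ^+ 2 + 2 * gamma - 1)) in
  smallest (fun A : set (R^o * R^o) => closed A /\ convex_set A)
    [set Q1; Q2; Q3; Q4].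

(* Main.v *)
Require Import Defs.
From mathcomp Require Import all_boot all_order all_algebra.
From mathcomp Require Import ring lra.
From mathcomp Require Import interval_inference.
From mathcomp Require Import all_classical all_reals all_analysis.
From mathcomp Require Import measurable_realfun ess_sup_inf.
Set Implicit Arguments.
Unset Strict Implicit.
Unset Printing Implicit Defensive.
Import Order.TTheory GRing.Theory Num.Theory.
Import numFieldNormedType.Exports.
Local Open Scope classical_set_scope.
Local Open Scope ring_scope.

(* Assume the maximal operator is bounded, with norm K, and write x = 1/p,
   y = 1/q, d = n + 1.  Testing it on a large ball gives y <= x.  The other edges
   of the quadrangle come from one family of Knapp examples, indexed by h in
   [0, 1].  Fix t0 in a set A of radii of diameter at most delta^(1 - 2h), and
   let f be a bump on a cap of the sphere of radius t0, of thickness delta and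
   width rho ~ delta^h.  If t is in A, |x'| <~ delta / rho and x_1 is within delta
   of t0 - sqrt(t^2 - |x'|^2), then the sphere of centre x and radius t stays in
   the plate along a whole cap, so that A_t f(x) >~ rho^n.  Since
   t |-> sqrt(t^2 - |x'|^2) expands distances, a delta/2-separated subset of A
   produces disjoint sets of such x, whence
     N(A, delta)^y <~ delta^(-s),  s = h n (1 - x - y) + d y - x.
   Here h = 0 is the neighbourhood of a sphere (edge Q1 Q4), h = 1 the ball of
   radius delta (edge Q2 Q3), h = 1/2 with A = E the edge Q3 Q4(beta), and
   h = (1 - theta)/2 with A = E cut by an interval of length delta^theta gives
   (1 - theta) dim_{A,theta} E y <= s, the edge Q3 Q4(gamma); in the regular case
   theta tends to 1 - beta/gamma. *)

(** * Integrals and norms of functions that need not be measurable *)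

Section Measure.
Context d (T : measurableType d) (R : realType).
Variable mu : {measure set T -> \bar R}.
Local Open Scope ereal_scope.

Import HBNNSimple.

(** The integral of a nonnegative function is a supremum over the simple functions below it, so
    monotonicity asks for no measurability. This allows lower bounds for the norm of
    [spherical_maximal], a supremum over an arbitrary set of radii. *)
Lemma ge0_le_integral_nonmeasurable (f g : T -> \bar R) :
  (forall x, 0 <= f x) -> (forall x, f x <= g x) ->
  \int[mu]_x f x <= \int[mu]_x g x.
Proof.
move=> f0 fg.
have g0 x : 0 <= g x := le_trans (f0 x) (fg x).
rewrite !ge0_integralTE//; apply: le_ereal_sup => _ [h hf <-].
by exists h => // x; exact: le_trans (hf x) (fg x).
Qed.

Lemma integral_ge_cst (A : set T) (c : R) (g : T -> \bar R) :
  measurable A -> (0 <= c)%R -> (forall x, 0 <= g x) ->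
  (forall x, A x -> c%:E <= g x) -> c%:E * mu A <= \int[mu]_x g x.
Proof.
move=> mA c0 g0 cg.
rewrite -[A in mu A]setIT -integral_indic// -ge0_integralZl//; last first.
  exact/measurable_EFinP/measurable_indic.
apply: ge0_le_integral_nonmeasurable => x.
  by rewrite mule_ge0// lee_fin.
rewrite indicE; case: (boolP (x \in A)) => [|_]; last by rewrite mule0.
by rewrite inE mule1; exact: cg.
Qed.

Lemma integral_le_cst (A : set T) (c : R) (g : T -> \bar R) :
  measurable A -> (0 <= c)%R -> (forall x, 0 <= g x) ->
  (forall x, A x -> g x <= c%:E) -> (forall x, ~ A x -> g x = 0) ->
  \int[mu]_x g x <= c%:E * mu A.
Proof.
move=> mA c0 g0 gc gA.
rewrite -[A in mu A]setIT -integral_indic// -ge0_integralZl//; last first.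
  exact/measurable_EFinP/measurable_indic.
apply: ge0_le_integral_nonmeasurable => x //.
rewrite indicE; case: (boolP (x \in A)) => [|/negP].
  by rewrite inE mule1; exact: gc.
by rewrite inE mule0 => /gA ->.
Qed.

(** Chebyshev's inequality, uniform in q: at q = +oo the exponent of w is 0, and [0 < w] makes A
    non-null, so that the essential supremum sees A. *)
Lemma Lnorm_ge_cst (A : set T) (c w : R) (q : \bar R) (g : T -> \bar R) :
  measurable A -> (0 < c)%R -> 1 <= q -> (0 < w)%R -> w%:E <= mu A ->
  (forall x, A x -> c%:E <= `|g x|) ->
  (c * w `^ fine q^-1%E)%:E <= 'N[mu]_q[g].
Proof.
move=> mA c0 q1 w0 wA cg; rewrite unlock; move: q q1 => [q||]// q1.
  have q0 : (0 < q)%R by rewrite (lt_le_trans ltr01).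
  rewrite fine_invr.
  have -> : (c * w `^ q^-1)%:E = ((c `^ q * w)%:E `^ q^-1).
    rewrite poweR_EFin powRM ?powR_ge0// ?ltW// -powRrM mulfV ?gt_eqF// powRr1//.
    exact: ltW.
  apply: gt0_ler_poweR => //; rewrite ?in_itv/= ?leey ?andbT//.
  - by rewrite invr_ge0 ltW.
  - by rewrite lee_fin mulr_ge0 ?powR_ge0// ltW.
  - by rewrite integral_ge0// => x _; rewrite poweR_ge0.
  apply: (@le_trans _ _ ((c `^ q)%:E * mu A)).
    by rewrite EFinM lee_wpmul2l// lee_fin powR_ge0.
  apply: integral_ge_cst => //; first by rewrite powR_ge0.
    by move=> x; rewrite poweR_ge0.
  move=> x Ax; rewrite -poweR_EFin.
  apply: gt0_ler_poweR => //; rewrite ?in_itv/= ?leey ?andbT//.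
  - exact: ltW.
  - by rewrite lee_fin ltW.
  - exact: cg.
have A0 : 0 < mu A by apply: lt_le_trans wA; rewrite lte_fin.
rewrite ifT; last first.
  apply: (lt_le_trans A0); apply: le_measure; rewrite ?inE//.
rewrite invey/= powRr0 mulr1.
rewrite leNgt; apply/negP => gc.
(* If the essential supremum were below c, its exceptional null set would contain A. *)
have [N [mN N0 gN]] := ess_sup_ge mu (abse \o g).
suff : mu A <= mu N by rewrite N0 leNgt A0.
apply: le_measure; rewrite ?inE// => x Ax; apply: gN => /= gx.
by have := lt_le_trans (le_lt_trans gx gc) (cg _ Ax); rewrite ltxx.
Qed.

Lemma Lnorm_le_cst (A : set T) (c v : R) (p : \bar R) (f : T -> R) :
  measurable A -> (0 < c)%R -> 1 <= p -> (0 < v)%R -> mu A <= v%:E ->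
  (forall x, 0 <= f x <= c)%R -> (forall x, ~ A x -> f x = 0%R) ->
  'N[mu]_p[EFin \o f] <= (c * v `^ fine p^-1%E)%:E.
Proof.
move=> mA c0 p1 v0 Av f0c fA; rewrite unlock; move: p p1 => [p||]// p1.
  have p0 : (0 < p)%R by rewrite (lt_le_trans ltr01).
  have -> : (c * v `^ fine p%:E^-1)%:E = (c `^ p * v)%:E `^ p^-1.
    rewrite fine_invr poweR_EFin powRM ?powR_ge0// ?ltW// -powRrM mulfV ?gt_eqF//.
    by rewrite powRr1// ltW.
  have fp x : `|(EFin \o f) x| `^ p = (f x `^ p)%:E.
    by have /andP[f0 _] := f0c x; rewrite /= ger0_norm ?poweR_EFin.
  apply: gt0_ler_poweR => //; rewrite ?in_itv/= ?leey ?andbT//.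
  - by rewrite invr_ge0 ltW.
  - by rewrite integral_ge0// => x _; rewrite poweR_ge0.
  - by rewrite lee_fin mulr_ge0 ?powR_ge0// ltW.
  apply: (@le_trans _ _ ((c `^ p)%:E * mu A)); last first.
    by rewrite EFinM lee_wpmul2l// lee_fin powR_ge0.
  apply: integral_le_cst => // [|x|x].
  - by rewrite powR_ge0.
  - have /andP[f0 fc] := f0c x.
    move=> _; apply: (@le_trans _ _ (f x `^ p)%:E); first by rewrite -fp.
    rewrite lee_fin ge0_ler_powR ?nnegrE//; first exact: ltW.
    exact: ltW.
  - by move=> /fA fx; apply: (etrans (fp x)); rewrite fx powR0// gt_eqF.
rewrite invey/= powRr0 mulr1; case: ifPn => [_|_]; last by rewrite lee_fin ltW.
apply/ess_supP/nearW => x /=; have /andP[f0 fc] := f0c x.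
by rewrite ger0_norm ?lee_fin.
Qed.

End Measure.

(** * Slicing Lebesgue measure in dimension n + 1 *)

Section LebesgueRow.
Context {R : realType} {n : nat}.
Local Open Scope ereal_scope.
Implicit Types (A : set 'rV[R]_n.+1) (m : R).

Lemma measurable_row_cons_preimage A : measurable A ->
  measurable (row_cons @^-1` A).
Proof.
by move=> mA; rewrite -[X in measurable X]setTI; exact: measurable_row_cons.
Qed.

(** Uniqueness of the product measure exchanges the order of integration built into [lebesgue_cons].
    With the last n coordinates fixed, the slices of the plates below are intervals. *)
Lemma lebesgue_row_consE A : measurable A ->
  lebesgue_row R n.+1 A =
  \int[lebesgue_row R n]_v lebesgue_measure [set a | A (row_cons (a, v))].
Proof.
move=> mA.
have := @product_measure_unique _ _ _ _ R (@lebesgue_measure R) (lebesgue_row R n)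
  (product_measure2 (@lebesgue_measure R) (lebesgue_row R n))
  (@product_measure2E _ _ _ _ R (@lebesgue_measure R) (lebesgue_row R n))
  _ (measurable_row_cons_preimage mA).
rewrite /= /lebesgue_cons /pushforward => ->.
rewrite /product_measure2; apply: eq_integral => v _ /=.
by congr lebesgue_measure; apply/seteqP; split => a /=; rewrite /ysection/= inE.
Qed.

Lemma lebesgue_row_cons_ge A (B : set 'rV[R]_n) m :
  measurable A -> measurable B -> (0 <= m)%R ->
  (forall v, B v -> m%:E <= lebesgue_measure [set a | A (row_cons (a, v))]) ->
  m%:E * lebesgue_row R n B <= lebesgue_row R n.+1 A.
Proof.
by move=> mA mB m0 AB; rewrite lebesgue_row_consE//; exact: integral_ge_cst.
Qed.

Lemma lebesgue_row_cons_le A (B : set 'rV[R]_n) m :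
  measurable A -> measurable B -> (0 <= m)%R ->
  (forall v, B v -> lebesgue_measure [set a | A (row_cons (a, v))] <= m%:E) ->
  (forall a v, A (row_cons (a, v)) -> B v) ->
  lebesgue_row R n.+1 A <= m%:E * lebesgue_row R n B.
Proof.
move=> mA mB m0 AB BA; rewrite lebesgue_row_consE//; apply: integral_le_cst => //.
move=> v Bv; rewrite (_ : mkset _ = set0) ?measure0//.
by apply/seteqP; split => a //= /BA.
Qed.

End LebesgueRow.

Lemma lebesgue_row_cube (R : realType) n (c : 'rV[R]_n) (r : R) : 0 < r ->
  lebesgue_row R n [set v | forall i, `|v ord0 i - c ord0 i| <= r] =
  ((2 * r) ^+ n)%:E.
Proof.
move=> r0.
have := @lebesgue_row_box R n (fun i => `[c ord0 i - r, c ord0 i + r]%classic).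
rewrite (_ : mkset _ = [set v | forall i, `|v ord0 i - c ord0 i| <= r]).
  move=> ->//.
  rewrite (eq_bigr (fun=> (2 * r)%:E)) => [|i _]; last first.
    rewrite lebesgue_measure_itv/= lte_fin ltrD2l gt0_cp// -EFinB; congr EFin.
    by ring.
  by rewrite prodEFin prodr_const card_ord.
by apply/seteqP; split => v /= h i; have := h i; rewrite in_itv/= ler_distl.
Qed.

Lemma measurable_cube (R : realType) n (c : 'rV[R]_n) (r : R) :
  measurable [set v : 'rV[R]_n | forall i, `|v ord0 i - c ord0 i| <= r].
Proof.
have := @measurable_box R n (fun i => `[c ord0 i - r, c ord0 i + r]%classic)
  (fun i => measurable_itv _).
congr (measurable _); apply/seteqP; split => v /= h i; have := h i.
  by rewrite in_itv/= ler_distl.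
by rewrite in_itv/= ler_distl.
Qed.

Lemma closed_measurable_row (R : realType) n (A : set 'rV[R]_n) :
  closed A -> measurable A.
Proof.
move=> cA; rewrite -(setCK A); apply: measurableC; apply: open_measurable_row.
exact: closed_openC.
Qed.

(** Slices at a fixed first coordinate a; the cube may move with a, as the cone over a spherical cap
    requires. *)
Lemma lebesgue_row_cons_ge_cube (R : realType) n (A : set 'rV[R]_n.+1)
    (B : set R) (c : R -> 'rV[R]_n) (r : R) :
  measurable A -> measurable B -> 0 < r ->
  (forall a (v : 'rV[R]_n), B a -> (forall i, `|v ord0 i - c a ord0 i| <= r) ->
    A (row_cons (a, v))) ->
  (((2 * r) ^+ n)%:E * lebesgue_measure B <= lebesgue_row R n.+1 A)%E.
Proof.
move=> mA mB r0 AB; apply: (@integral_ge_cst _ (measurableTypeR R)) => //.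
  by rewrite exprn_ge0// mulr_ge0// ltW.
move=> a Ba /=; rewrite -(lebesgue_row_cube (c a) r0); apply: le_measure.
- by rewrite inE; exact: measurable_cube.
- by rewrite inE; apply: measurable_xsection; exact: measurable_row_cons_preimage.
- by move=> v /= av; rewrite /xsection/= inE; exact: AB.
Qed.

(** * Testing the maximal operator on a bump function *)

Lemma continuous_affine (R : realType) n (x : 'rV[R]_n.+1) (t : R) :
  continuous (fun y : 'rV[R]_n.+1 => x - t *: y : 'rV[R]_n.+1).
Proof.
move=> u.
exact: (@cvgB _ _ _ (nbhs u) _ (fun=> x) (t \*: id) x (t *: u) (cvg_cst x)
  (@cvgZl_tmp _ _ _ (nbhs u) _ t id u (@cvg_id _ _))).
Qed.

Lemma measurable_translate_ge (R : realType) n (f : 'rV[R]_n.+1 -> R) (c : R)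
    (x : 'rV[R]_n.+1) (t : R) :
  continuous f -> measurable [set y : 'rV[R]_n.+1 | c <= f (x - t *: y)].
Proof.
move=> cf; apply: closed_measurable_row.
apply: (@closed_comp _ _ (fun y : 'rV[R]_n.+1 => f (x - t *: y)) [set r | c <= r]).
  by move=> y _; exact: (continuous_comp (@continuous_affine _ _ x t y) (cf _)).
exact: closed_ge.
Qed.

(** Dividing f by v^(1/p) gives a function of norm at most 1, whose maximal function is at least c
    v^(-1/p) on A; the lower norm bound on A then compares with K. *)
Lemma spherical_test (R : realType) n (E : set R) (p q : \bar R) (K : R)
    (f : 'rV[R]_n.+1 -> R) (S A : set 'rV[R]_n.+1) (v w c : R) :
  (1 <= p)%E -> (1 <= q)%E -> (spherical_maximal_norm n.+1 E p q <= K%:E)%E ->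
  continuous f -> (forall x, 0 <= f x <= 1) ->
  measurable S -> (forall x, ~ S x -> f x = 0) ->
  0 < v -> (lebesgue_row R n.+1 S <= v%:E)%E ->
  measurable A -> 0 < w -> (w%:E <= lebesgue_row R n.+1 A)%E -> 0 < c ->
  (forall x, A x -> exists2 t, E t &
    (c%:E <= sphere_measure [set y | 1 <= f (x - t *: y)]%R)%E) ->
  c * w `^ fine q^-1%E <= K * v `^ fine p^-1%E.
Proof.
move=> p1 q1 normK cf f01 mS fS v0 Sv mA w0 wA c0 Ac.
pose x := fine p^-1%E; rewrite -/x.
have vx0 : 0 < v `^ x by rewrite powR_gt0.
pose k := (v `^ x)^-1; have k0 : 0 < k by rewrite invr_gt0.
pose g z := k * f z.
have cg : continuous g.
  by move=> z; exact: (continuousM (@cst_continuous _ _ k z) (cf z)).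
have g1 : ('N[lebesgue_row R n.+1]_p[EFin \o g] <= 1)%E.
  rewrite (_ : 1%E = (k * v `^ x)%:E); last by rewrite mulVf// gt_eqF.
  apply: (@Lnorm_le_cst _ _ _ _ S) => // z; last by move=> /fS; rewrite /g => ->; rewrite mulr0.
  by have /andP[f0 f1] := f01 z; rewrite /g mulr_ge0 ?(ltW k0)//= ger_pMr.
have gA z : A z -> ((k * c)%:E <= `|spherical_maximal E g z|)%E.
  move=> Az; have [t Et ct] := Ac _ Az.
  have mt := measurable_translate_ge 1 z t cf.
  have km : ((k * c)%:E <= spherical_mean t g z)%E.
    rewrite EFinM.
    apply: le_trans (@integral_ge_cst _ _ _ _ _ k _ mt _ _ _).
    - by rewrite lee_wpmul2l// lee_fin ltW.
    - exact: ltW.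
    - by move=> y; have /andP[f0 _] := f01 (z - t *: y); rewrite lee_fin mulr_ge0// ltW.
    - by move=> y /= f1; rewrite lee_fin /g ler_peMr// ltW.
  apply: (le_trans km); apply: (le_trans (lee_abs _)).
  apply: (@le_trans _ _ (spherical_maximal E g z)); last exact: lee_abs.
  by apply: ereal_sup_ubound; exists t.
have := @Lnorm_ge_cst _ _ _ _ A (k * c) w q _ mA (mulr_gt0 k0 c0) q1 w0 wA gA.
move=> kc; have {kc} : ((k * c * w `^ fine q^-1)%:E <= K%:E)%E.
  apply: (le_trans kc); apply: le_trans normK.
  by apply: ereal_sup_ubound; exists g.
by rewrite lee_fin -mulrA /k ler_pdivrMl// [leRHS]mulrC.
Qed.

(** * Cutoff functions and curved plates *)

Lemma row_cons0 (R : realType) n (a : R) (v : 'rV[R]_n) :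
  row_cons (a, v) ord0 ord0 = a.
Proof.
rewrite /row_cons mxE; case: splitP => [j _|k /= kE]; first by rewrite mxE.
by rewrite add1n in kE.
Qed.

Lemma row_cons_lift (R : realType) n (a : R) (v : 'rV[R]_n) i :
  row_cons (a, v) ord0 (lift ord0 i) = v ord0 i.
Proof.
rewrite /row_cons mxE; case: splitP => [[[|//] j] //=|k /= kE].
by move: kE; rewrite /bump /= add1n => -[/val_inj ->].
Qed.

(** Piecewise linear, since test functions only have to be continuous. *)
Definition cutoff (R : realType) (s : R) : R := Num.min 1 (Num.max 0 (2 - s)).

Lemma cutoff_ge0_le1 (R : realType) (s : R) : 0 <= cutoff s <= 1.
Proof. by rewrite /cutoff le_min ler01/= le_max lexx/= ge_min lexx. Qed.

Lemma cutoff1 (R : realType) (s : R) : s <= 1 -> cutoff s = 1.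
Proof.
move=> s1; rewrite /cutoff; apply/min_idPl; rewrite le_max; apply/orP; right.
lra.
Qed.

Lemma cutoff0 (R : realType) (s : R) : 2 <= s -> cutoff s = 0.
Proof.
move=> s2; rewrite /cutoff (_ : Num.max _ _ = 0); first by apply/min_idPr.
by apply/max_idPl; lra.
Qed.

Lemma continuous_cutoff (R : realType) : continuous (@cutoff R).
Proof.
apply: (@min_fun_continuous _ _ R (fun=> 1)); first exact: cst_continuous.
apply: (@max_fun_continuous _ _ R (fun=> 0)); first exact: cst_continuous.
by move=> s; exact: (continuousB (@cst_continuous _ _ (2 : R^o) s) (@cvg_id _ _)).
Qed.

Definition tail_sqr (R : realType) n (x : 'rV[R]_n.+1) : R :=
  \sum_(i < n) x ord0 (lift ord0 i) ^+ 2.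

Lemma tail_sqr_ge0 (R : realType) n (x : 'rV[R]_n.+1) : 0 <= tail_sqr x.
Proof. by apply: sumr_ge0 => i _; exact: sqr_ge0. Qed.

Lemma continuous_tail_sqr (R : realType) n : continuous (@tail_sqr R n).
Proof.
apply: continuous_big => [|i _]; first exact: add_continuous.
move=> x.
exact: (continuous_comp (@coord_continuous R _ _ ord0 (lift ord0 i) x)
  (@exprn_continuous R 2 _)).
Qed.

(** A neighbourhood of the graph x_1 = u(|x'|^2), where x = (x_1, x'). It is used with u(s) =
    sqrt(t0^2 - s), for the support of the bump, and with u(s) = t0 - sqrt(t^2 - s), for the centres
    x whose sphere of radius t follows that cap. *)
Definition plate (R : realType) n (u : R -> R) (a b : R) : set 'rV[R]_n.+1 :=
  [set x : 'rV[R]_n.+1 | `|x ord0 ord0 - u (tail_sqr x)| <= a /\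
    forall i, `|x ord0 (lift ord0 i)| <= b].

Arguments plate {R} n u a b _.

Lemma measurable_plate (R : realType) n (u : R -> R) (a b : R) :
  continuous u -> measurable (plate n u a b).
Proof.
move=> cu; apply: closed_measurable_row.
rewrite (_ : plate n u a b = [set x : 'rV[R]_n.+1 | `|x ord0 ord0 - u (tail_sqr x)| <= a] `&`
  \bigcap_(i in [set: 'I_n]) [set x : 'rV[R]_n.+1 | `|x ord0 (lift ord0 i)| <= b]); last first.
  apply/seteqP; split => [x [xa xb]|x [xa xb]]; split=> // i.
    by move=> _; exact: xb.
  exact: (xb i I).
have cl (r : R) (f : 'rV[R]_n.+1 -> R) : continuous f ->
    closed [set x : 'rV[R]_n.+1 | `|f x| <= r].
  move=> cf; apply: (@closed_comp _ _ (fun x => `|f x|) [set s | s <= r]).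
    by move=> x _; exact: (continuous_comp (cf x) (@norm_continuous _ R^o _)).
  exact: closed_le.
apply: closedI.
  apply: (cl a (fun x : 'rV[R]_n.+1 => x ord0 ord0 - u (tail_sqr x))) => x.
  apply: continuousB; first exact: coord_continuous.
  by apply: continuous_comp; [exact: continuous_tail_sqr|exact: cu].
apply: closed_bigI => i _; apply: (cl b (fun x : 'rV[R]_n.+1 => x ord0 (lift ord0 i))).
exact: coord_continuous.
Qed.

(** Over each x' in the cube the slice is an interval of length 2a centred at u(|x'|^2), so the
    volume does not depend on u. *)
Lemma lebesgue_row_plate (R : realType) n (u : R -> R) (a b : R) :
  continuous u -> 0 < a -> 0 < b ->
  lebesgue_row R n.+1 (plate n u a b) = (2 * a * (2 * b) ^+ n)%:E.
Proof.
move=> cu a0 b0.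
have mS := @measurable_plate R n u a b cu.
have mC := @measurable_cube R n 0 b.
have leC := @lebesgue_row_cube R n 0 b b0.
have a20 : 0 <= 2 * a by rewrite mulr_ge0// ltW.
have sec (v : 'rV[R]_n) : (forall i, `|v ord0 i - (0 : 'rV[R]_n) ord0 i| <= b) ->
    lebesgue_measure [set s | plate n u a b (row_cons (s, v))] = (2 * a)%:E.
  move=> vb; pose m := u (\sum_i v ord0 i ^+ 2).
  rewrite (_ : mkset _ = `[m - a, m + a]%classic).
    rewrite lebesgue_measure_itv/= lte_fin ltrD2l gt0_cp// -EFinB; congr EFin.
    by ring.
  have tE s : tail_sqr (row_cons (s, v)) = \sum_i v ord0 i ^+ 2.
    by apply: eq_bigr => i _; rewrite row_cons_lift.
  apply/seteqP; split => s /=; rewrite /plate/= row_cons0 tE -/m in_itv/=.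
    by rewrite -ler_distl => -[].
  rewrite -ler_distl => sa; split => // i; rewrite row_cons_lift.
  by have := vb i; rewrite mxE subr0.
apply/eqP; rewrite eq_le EFinM -leC; apply/andP; split.
  apply: (lebesgue_row_cons_le mS mC a20) => [v /sec ->//|s v [_ sv] i].
  by rewrite mxE subr0; have := sv i; rewrite row_cons_lift.
by apply: (lebesgue_row_cons_ge mS mC a20) => v /sec ->.
Qed.

(** * Geometry of a sphere near a cap *)

(** Here a = |x'|^2, b = |z'|^2 and c = x'.z', so the first root is sqrt(t^2 - |x' - z'|^2). The
    quantity measures how far the sphere of radius t, translated to touch the cap of radius t0 over
    the origin, departs from that cap at z'. *)
Lemma sqrt_sub_bound (R : realType) (t t0 r a b c X rho : R) :
  1 <= t <= 2 -> 1 <= t0 <= 2 -> `|t - t0| <= r ->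
  0 <= a <= X ^+ 2 -> 0 <= b <= rho ^+ 2 -> `|c| <= X * rho ->
  0 <= X <= 4^-1 -> 0 <= rho <= 4^-1 ->
  `|Num.sqrt (t ^+ 2 - (a - 2 * c + b)) - Num.sqrt (t ^+ 2 - a) + t0
     - Num.sqrt (t0 ^+ 2 - b)| <= 3 * X * rho + 8 * rho ^+ 2 * r.
Proof.
move=> /andP[t1 t2] /andP[s1 s2] tr /andP[a0 aX] /andP[b0 bX] cX /andP[X0 X4] /andP[r0 r4].
have X2 : X ^+ 2 <= 16^-1 by nra.
have rho2 : rho ^+ 2 <= 16^-1 by nra.
have Xr : X * rho <= 16^-1 by nra.
have Xr0 : 0 <= X * rho by nra.
have tt : 1 <= t ^+ 2 by nra.
have ss : 1 <= t0 ^+ 2 by nra.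
move: cX; rewrite ler_norml => /andP[c1 c2].
pose S1 := Num.sqrt (t ^+ 2 - (a - 2 * c + b)).
pose S2 := Num.sqrt (t ^+ 2 - a).
pose S3 := Num.sqrt (t0 ^+ 2 - b).
rewrite -/S1 -/S2 -/S3.
have E1 : S1 ^+ 2 = t ^+ 2 - (a - 2 * c + b) by rewrite sqr_sqrtr//; lra.
have E2 : S2 ^+ 2 = t ^+ 2 - a by rewrite sqr_sqrtr//; lra.
have E3 : S3 ^+ 2 = t0 ^+ 2 - b by rewrite sqr_sqrtr//; lra.
have S10 : 0 <= S1 by exact: sqrtr_ge0.
have S20 : 0 <= S2 by exact: sqrtr_ge0.
have S30 : 0 <= S3 by exact: sqrtr_ge0.
have S11 : 2^-1 <= S1 by nra.
have S21 : 2^-1 <= S2 by nra.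
have S31 : 2^-1 <= S3 by nra.
have D1 : 1 <= S1 + S2 by lra.
have D2 : 1 <= t0 + S3 by lra.
have D1p : 0 < S1 + S2 := lt_le_trans ltr01 D1.
have D2p : 0 < t0 + S3 := lt_le_trans ltr01 D2.
have dt : `|t ^+ 2 - t0 ^+ 2| <= 4 * r.
  rewrite subr_sqr normrM mulrC ler_pM// ger0_norm; lra.
have div (u v w : R) : 1 <= w -> u * w = v -> `|u| <= `|v|.
  by move=> w1 <-; rewrite normrM ler_peMr// ger0_norm// (le_trans ler01).
have H1 : `|S1 - S3| <= 4 * r + X ^+ 2 + 2 * (X * rho).
  apply: (@le_trans _ _ `|t ^+ 2 - t0 ^+ 2 - a + 2 * c|).
    apply: (div _ _ (S1 + S3)); first lra.
    rewrite -subr_sqr E1 E3; lra.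
  move: dt; rewrite !ler_norml => /andP[dt1 dt2].
  by clear - dt1 dt2 aX a0 c1 c2; apply/andP; split; lra.
have H2 : `|S2 - t0| <= 4 * r + X ^+ 2.
  apply: (@le_trans _ _ `|t ^+ 2 - t0 ^+ 2 - a|).
    apply: (div _ _ (S2 + t0)); first lra.
    rewrite -subr_sqr E2; lra.
  move: dt; rewrite !ler_norml => /andP[dt1 dt2].
  by clear - dt1 dt2 aX a0; apply/andP; split; lra.
have DD : `|(S1 + S2) - (t0 + S3)| <= 8 * r + 2 * (X * rho) + 2 * X ^+ 2.
  move: H1 H2; rewrite !ler_norml => /andP[h1 h2] /andP[h3 h4].
  by clear - h1 h2 h3 h4; apply/andP; split; lra.
have r0' : 0 <= r := le_trans (normr_ge0 _) tr.
set DE := 8 * r + 2 * (X * rho) + 2 * X ^+ 2 in DD.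
have F1 : (S1 - S2) * (S1 + S2) = 2 * c - b by rewrite -subr_sqr E1 E2; ring.
have F2 : (t0 - S3) * (t0 + S3) = b by rewrite -subr_sqr E3; ring.
have D12 : 0 < (S1 + S2) * (t0 + S3) by exact: mulr_gt0.
(* Over a common denominator the terms in b combine into b times the difference of the two
   denominators, small by [DD]. Bounding the two fractions separately would leave an error of order
   rho^2. *)
have HD : (S1 - S2 + t0 - S3) * ((S1 + S2) * (t0 + S3)) =
    2 * c * (t0 + S3) + b * ((S1 + S2) - (t0 + S3)).
  transitivity ((S1 - S2) * (S1 + S2) * (t0 + S3) + (t0 - S3) * (t0 + S3) * (S1 + S2)).
    by ring.
  by rewrite F1 F2; ring.
have HE : `|S1 - S2 + t0 - S3| <= 2 * (X * rho) + rho ^+ 2 * DE.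
  rewrite -(ler_pM2r D12) -[in leLHS](gtr0_norm D12) -normrM HD.
  apply: (le_trans (ler_normD _ _)); rewrite [leRHS]mulrDl; apply: lerD.
    rewrite !normrM ger0_norm// (gtr0_norm D2p).
    rewrite [leRHS]mulrA; apply: ler_wpM2r; first exact: ltW.
    apply: (@le_trans _ _ (2 * (X * rho) * 1)).
      by rewrite mulr1 ler_wpM2l// ler_norml c1.
    by rewrite ler_wpM2l// mulr_ge0.
  have DE0 : 0 <= DE := le_trans (normr_ge0 _) DD.
  rewrite normrM (ger0_norm b0); apply: (@le_trans _ _ (rho ^+ 2 * DE * 1)).
    by rewrite mulr1 ler_pM.
  apply: ler_wpM2l; first by rewrite mulr_ge0// sqr_ge0.
  rewrite -[leLHS]mul1r ler_pM//.
apply: (le_trans HE); rewrite /DE.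
(* The remaining terms rho^2 (2 X rho + 2 X^2) are absorbed into X rho, as X and rho are at most
   1/4. *)
have k1 : rho ^+ 2 * (2 * (X * rho)) <= 8^-1 * (X * rho).
  apply: (@le_trans _ _ (16^-1 * (2 * (X * rho)))); last by clear - Xr0; lra.
  by rewrite ler_wpM2r// mulr_ge0.
have k2 : rho ^+ 2 * (2 * X ^+ 2) <= 8^-1 * (X * rho).
  rewrite (_ : _ * _ = 2 * (X * rho) * (X * rho)); last by ring.
  apply: (@le_trans _ _ (2 * (X * rho) * 16^-1)); last by clear - Xr0; lra.
  by rewrite ler_wpM2l// mulr_ge0.
by rewrite !mulrDr; clear - k1 k2 Xr0; lra.
Qed.

(** The unit vector along (1, w) has tail w / W. Its Lipschitz dependence on w lets caps be
    described by slopes, which suit cones better than angles. *)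
Lemma normalize_lipschitz (R : realType) n (b w : 'I_n -> R) (k : R) :
  let B := Num.sqrt (1 + \sum_i b i ^+ 2) in
  let W := Num.sqrt (1 + \sum_i w i ^+ 2) in
  (forall i, `|b i| <= (4 * n.+1%:R)^-1) -> (forall i, `|w i - b i| <= k) ->
  k <= 1 -> forall i, `|b i / B - w i / W| <= 3 * n.+1%:R * k.
Proof.
move=> B W bN wb k1 i; set D : R := n.+1%:R in bN *.
have D1 : 1 <= D by rewrite ler1n.
have nD : n%:R + 1 = D by rewrite /D -natr1.
have b4 j : `|b j| <= 4^-1.
  by apply: (le_trans (bN j)); rewrite lef_pV2 ?posrE//; lra.
have k0 : 0 <= k := le_trans (normr_ge0 _) (wb i).
have sB : 0 <= \sum_j b j ^+ 2 by apply: sumr_ge0 => j _; exact: sqr_ge0.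
have sW : 0 <= \sum_j w j ^+ 2 by apply: sumr_ge0 => j _; exact: sqr_ge0.
have BE : B ^+ 2 = 1 + \sum_j b j ^+ 2 by rewrite sqr_sqrtr//; lra.
have WE : W ^+ 2 = 1 + \sum_j w j ^+ 2 by rewrite sqr_sqrtr//; lra.
have B0 : 0 <= B by exact: sqrtr_ge0.
have W0 : 0 <= W by exact: sqrtr_ge0.
have B1 : 1 <= B by nra.
have W1 : 1 <= W by nra.
have sB1 : \sum_j b j ^+ 2 <= 1.
  apply: (@le_trans _ _ (\sum_(j < n) D^-1)); last first.
    by rewrite sumr_const card_ord -[leLHS]mulr_natl ler_pdivrMr; lra.
  apply: ler_sum => j _; have := bN j; have := b4 j; rewrite invfM => h1 h2.
  have := ler_pM (normr_ge0 _) (normr_ge0 _) h1 h2.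
  rewrite -normrM -expr2 ger0_norm ?sqr_ge0// => /le_trans; apply.
  have : 0 < D^-1 by rewrite invr_gt0; lra.
  by move: (D^-1) => u; lra.
have B2 : B <= 2 by nra.
have WB : `|W - B| <= n%:R * k.
  have h : `|W ^+ 2 - B ^+ 2| <= 2 * (n%:R * k).
    rewrite WE BE opprD addrACA subrr add0r -sumrB.
    apply: (le_trans (ler_norm_sum _ _ _)).
    apply: (@le_trans _ _ (\sum_(j < n) 2 * k)); last first.
      by rewrite sumr_const card_ord -[leLHS]mulr_natl; lra.
    apply: ler_sum => j _; rewrite subr_sqr normrM mulrC ler_pM//.
    have := wb j; have := b4 j; rewrite !ler_norml; lra.
  move: h; rewrite subr_sqr normrM => h.
  have h2 : 2 <= `|W + B| by rewrite ger0_norm; lra.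
  rewrite -(ler_pM2l (ltr0Sn R 1)); apply: le_trans h.
  by rewrite mulrC ler_wpM2l.
have -> : b i / B - w i / W = (b i * (W - B) + (b i - w i) * B) / (B * W).
  by field; apply/andP; split; lra.
have BW1 : 1 <= B * W by nra.
rewrite normrM normfV (ger0_norm (x := B * W)); last lra.
rewrite ler_pdivrMr; last lra.
apply: (@le_trans _ _ (3 * D * k * 1)); last first.
  by apply: ler_wpM2l => //; rewrite !mulr_ge0//; lra.
rewrite mulr1 (le_trans (ler_normD _ _))// !normrM (ger0_norm B0) [`|b i - w i|]distrC.
have u1 : `|b i| * `|W - B| <= 1 * (n%:R * k) by rewrite ler_pM//; have := b4 i; lra.
have u2 : `|w i - b i| * B <= k * 2 by rewrite ler_pM.
have k3 : 0 <= (D - 1) * k by rewrite mulr_ge0//; lra.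
have nk : n%:R * k = D * k - k by rewrite -nD; ring.
lra.
Qed.

Lemma enorm_sqr (R : realType) n (z : 'rV[R]_n.+1) :
  enorm z ^+ 2 = z ord0 ord0 ^+ 2 + tail_sqr z.
Proof.
rewrite sqr_sqrtr; first by rewrite big_ord_recl.
by apply: sumr_ge0 => i _; exact: sqr_ge0.
Qed.

(** The hypothesis on z says that its slope z'/|z_1| is within k of x'/r, with r = sqrt(t^2 -
    |x'|^2). For slope exactly x'/r the point x - t y, y the direction of z, lies on the x_1-axis; a
    perturbation of size k moves its tail by O(k). As z_1 < 0, the point is on the upper half of the
    sphere, whence the sign of the root. *)
Lemma plate_hit (R : realType) n (x z : 'rV[R]_n.+1) (t k : R) :
  let D : R := n.+1%:R in
  let z' := x - t *: direction z in
  1 <= t <= 2 -> (forall i, `|x ord0 (lift ord0 i)| <= (8 * D)^-1) ->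
  k <= D^-1 -> - 2^-1 <= z ord0 ord0 <= - 4^-1 ->
  (forall i, `|z ord0 (lift ord0 i) + z ord0 ord0 *
     (x ord0 (lift ord0 i) / Num.sqrt (t ^+ 2 - tail_sqr x))| <= k / 4) ->
  [/\ forall i, `|z' ord0 (lift ord0 i)| <= 6 * D * k,
      z' ord0 ord0 = x ord0 ord0 + Num.sqrt (t ^+ 2 - (tail_sqr x -
        2 * (\sum_i x ord0 (lift ord0 i) * z' ord0 (lift ord0 i)) + tail_sqr z'))
    & enorm z <= 1].
Proof.
move=> D z' /andP[t1 t2] xD kD /andP[z1 z2] zb.
have D1 : 1 <= D by rewrite ler1n.
have nD : n%:R + 1 = D by rewrite /D -natr1.
have DE : n.+1%:R = D by [].
clearbody D.
set r := Num.sqrt (t ^+ 2 - tail_sqr x) in zb.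
have Di0 : 0 < D^-1 by rewrite invr_gt0; lra.
have Di1 : D^-1 <= 1 by rewrite invf_le1; lra.
have DD : D * D^-1 = 1 by rewrite mulfV// gt_eqF//; lra.
have sumD (f : 'I_n -> R) (c : R) : 0 <= c -> (forall i, `|f i| <= c / D) ->
    \sum_i f i ^+ 2 <= c ^+ 2.
  move=> c0 fc; apply: (@le_trans _ _ (\sum_(i < n) (c / D) ^+ 2)).
    apply: ler_sum => i _; rewrite -[leLHS]real_normK ?num_real//.
    by rewrite ler_pXn2r ?nnegrE// mulr_ge0//; exact: ltW.
  rewrite sumr_const card_ord -[leLHS]mulr_natl exprMn mulrCA ler_piMr ?sqr_ge0//.
  rewrite (_ : n%:R = D - 1); last lra.
  rewrite expr2 mulrBl mulrA DD.
  move: (D^-1) Di0 Di1 => u; nra.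
have x8 i : `|x ord0 (lift ord0 i)| <= 8^-1 / D by have := xD i; rewrite invfM.
have a8 : tail_sqr x <= (8^-1) ^+ 2 by apply: sumD => //; lra.
have a0 := tail_sqr_ge0 x.
have rE : r ^+ 2 = t ^+ 2 - tail_sqr x by rewrite sqr_sqrtr//; nra.
have r0 : 0 <= r by exact: sqrtr_ge0.
have r2 : 2^-1 <= r by nra.
pose s := - z ord0 ord0.
have zs : z ord0 ord0 = - s by rewrite /s opprK.
have s1 : 4^-1 <= s by rewrite /s; lra.
have s2 : s <= 2^-1 by rewrite /s; lra.
pose b i := x ord0 (lift ord0 i) / r.
pose w i := z ord0 (lift ord0 i) / s.
pose B := Num.sqrt (1 + \sum_i b i ^+ 2).
pose W := Num.sqrt (1 + \sum_i w i ^+ 2).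
have sW : 0 <= \sum_j w j ^+ 2 by apply: sumr_ge0 => j _; exact: sqr_ge0.
have WE : W ^+ 2 = 1 + \sum_j w j ^+ 2 by rewrite sqr_sqrtr//; lra.
have W0 : 0 <= W by exact: sqrtr_ge0.
have W1 : 1 <= W by nra.
have rn0 : r != 0 by rewrite gt_eqF//; lra.
have sn0 : s != 0 by rewrite gt_eqF//; lra.
have Wn0 : W != 0 by rewrite gt_eqF//; lra.
have tn0 : t != 0 by rewrite gt_eqF//; lra.
have b4 i : `|b i| <= (4 * D)^-1.
  rewrite normrM normfV (ger0_norm r0) ler_pdivrMr; last lra.
  apply: (le_trans (xD i)); rewrite !invfM; move: (D^-1) Di0 => u u0; nra.
have wb i : `|w i - b i| <= k.
  have -> : w i - b i = (z ord0 (lift ord0 i) + z ord0 ord0 *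
     (x ord0 (lift ord0 i) / r)) / s.
    by rewrite zs /w /b; field; rewrite rn0 sn0.
  have k40 : 0 <= k / 4 := le_trans (normr_ge0 _) (zb i).
  rewrite normrM normfV (ger0_norm (x := s)); last lra.
  rewrite ler_pdivrMr; last lra.
  apply: (le_trans (zb i)); nra.
have k1 : k <= 1 by lra.
(* Equivalently x' = t b / B: the direction of slope b leads from x to the axis. *)
have BE : B = t / r.
  rewrite /B (_ : 1 + _ = (t / r) ^+ 2).
    by rewrite sqrtr_sqr ger0_norm// divr_ge0//; exact: le_trans t1.
  have -> : \sum_i b i ^+ 2 = tail_sqr x / r ^+ 2.
    by rewrite /tail_sqr mulr_suml; apply: eq_bigr => i _; rewrite exprMn exprVn.
  rewrite (_ : tail_sqr x = t ^+ 2 - r ^+ 2); last by rewrite rE; ring.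
  by field.
have enE : enorm z = s * W.
  have -> : enorm z = Num.sqrt ((s * W) ^+ 2).
    rewrite -[LHS]ger0_norm ?sqrtr_ge0// -sqrtr_sqr enorm_sqr; congr Num.sqrt.
    rewrite zs sqrrN exprMn WE mulrDr mulr1 mulr_sumr; congr (_ + _).
    by apply: eq_bigr => i _; rewrite /w -exprMn; congr (_ ^+ 2); field.
  by rewrite sqrtr_sqr ger0_norm// mulr_ge0//; lra.
have zE i : z' ord0 (lift ord0 i) = t * (b i / B - w i / W).
  rewrite /z' /direction !mxE enE BE /b /w; field.
  by rewrite ?tn0 ?rn0 ?sn0 ?Wn0.
split.
- move=> i; rewrite zE normrM ger0_norm; last lra.
  rewrite -DE in b4; have := @normalize_lipschitz R n b w k b4 wb k1 i.
  rewrite DE => h; rewrite (_ : 6 * D * k = 2 * (3 * D * k)); last by ring.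
  by rewrite ler_pM//; lra.
- have -> : z' ord0 ord0 = x ord0 ord0 + t / W.
    rewrite /z' /direction !mxE enE zs; field.
    by rewrite ?tn0 ?rn0 ?sn0 ?Wn0.
  congr (_ + _); rewrite (_ : _ - _ = (t / W) ^+ 2).
    by rewrite sqrtr_sqr ger0_norm// divr_ge0//; exact: le_trans t1.
  have -> : tail_sqr x - 2 * (\sum_i x ord0 (lift ord0 i) * z' ord0 (lift ord0 i))
      + tail_sqr z' = t ^+ 2 * (\sum_i w i ^+ 2) / W ^+ 2.
    rewrite /tail_sqr mulr_sumr -sumrB -big_split mulr_sumr mulr_suml /=.
    apply: eq_bigr => i _; rewrite zE.
    have -> : x ord0 (lift ord0 i) = t * (b i / B).
      by rewrite BE /b; field; rewrite ?tn0 ?rn0.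
    by field; rewrite ?BE ?mulf_neq0 ?invr_eq0 ?tn0 ?rn0 ?Wn0.
  by rewrite (_ : \sum_i w i ^+ 2 = W ^+ 2 - 1); [field|rewrite WE; ring].
(* Each slope is at most 1/(4D) + k, hence at most 5/(4D), so W is at most 2 while s is at most
   1/2. *)
- have w2 : \sum_i w i ^+ 2 <= (5 / 4) ^+ 2.
    apply: sumD => [|i]; first lra.
    have := ler_normD (w i - b i) (b i); rewrite subrK => h.
    have := wb i; have := b4 i; rewrite invfM; move: (D^-1) kD h => u; lra.
  rewrite enE; have : W ^+ 2 <= 2 ^+ 2 by rewrite WE; lra.
  nra.
Qed.

(** Sphere measure is normalized cone volume. The slab of the cone with first coordinate in
    [-1/2, -1/4] has sections containing a cube of side k/2, which gives a volume at least (k/2)^n /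
    4. *)
Lemma sphere_measure_cap_ge (R : realType) n : exists2 c : R, 0 < c &
  forall (A : set 'rV[R]_n.+1) (b : 'rV[R]_n) (k : R), measurable A -> 0 < k ->
  (forall z : 'rV[R]_n.+1, - 2^-1 <= z ord0 ord0 <= - 4^-1 ->
    (forall i, `|z ord0 (lift ord0 i) + z ord0 ord0 * b ord0 i| <= k / 4) ->
    A (direction z) /\ enorm z <= 1) ->
  ((c * k ^+ n)%:E <= sphere_measure A)%E.
Proof.
have /andP[u0 uoo] := unit_ball_gt0_lty R n.+1.
have uE : lebesgue_row R n.+1 unit_ball = (fine (lebesgue_row R n.+1 unit_ball))%:E.
  by rewrite fineK// ge0_fin_numE// ltW.
set u := fine _ in uE.
have u1 : 0 < u by rewrite -lte_fin -uE.
exists (2^-1 ^+ n * 4^-1 / u) => [|A b k mA k0 Ab].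
  by rewrite !mulr_gt0// ?exprn_gt0// invr_gt0.
rewrite sphere_measureE -/u.
have mdA : measurable (direction @^-1` A `&` unit_ball).
  apply: measurableI; last exact: measurable_unit_ball.
  by rewrite -[X in measurable X]setTI; exact: measurable_direction.
have k4 : 0 < k / 4 by rewrite divr_gt0.
have := @lebesgue_row_cons_ge_cube R n _ `[- 2^-1, - 4^-1]%classic
  (fun a => - a *: b) (k / 4) mdA (measurable_itv _) k4.
have vE : lebesgue_measure `[(- 2^-1 : R), - 4^-1]%classic = (4^-1)%:E.
  rewrite lebesgue_measure_itv/= lte_fin ifT; last lra.
  by rewrite -EFinB; congr EFin; lra.
rewrite vE => h.
rewrite (_ : 2^-1 ^+ n * 4^-1 / u * k ^+ n = (2 * (k / 4)) ^+ n * 4^-1 * u^-1).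
  rewrite EFinM lee_wpmul2r ?lee_fin ?invr_ge0 ?(ltW u1)// EFinM; apply: h.
  move=> a v /=; rewrite in_itv/= => a12 va; apply: Ab; first by rewrite row_cons0.
  move=> i; rewrite row_cons0 row_cons_lift; have := va i.
  by rewrite !mxE mulNr opprK.
rewrite (_ : 2 * (k / 4) = 2^-1 * k); last by field.
by rewrite exprMn; ring.
Qed.

(** * The Knapp function and its spherical means *)

(** The bump f of the Knapp example. Cutting |z'|^2 at scale rho^2 confines the support to |z'| <
    sqrt(2) rho, inside the cube of half-side 2 rho of [knapp_eq0]. *)
Definition knapp (R : realType) n (t0 delta rho : R) (z : 'rV[R]_n.+1) : R :=
  cutoff (`|z ord0 ord0 - Num.sqrt (t0 ^+ 2 - tail_sqr z)| / delta) *
  cutoff (tail_sqr z / rho ^+ 2).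

Lemma continuous_sqrt_sub (R : realType) (t : R) :
  continuous (fun s : R => Num.sqrt (t - s)).
Proof.
move=> s; apply: (@continuous_comp _ _ _ (fun s : R => t - s)).
  exact: (continuousB (@cst_continuous _ _ (t : R^o) s) (@cvg_id _ _)).
exact: sqrt_continuous.
Qed.

Lemma continuous_knapp (R : realType) n (t0 delta rho : R) :
  continuous (@knapp R n t0 delta rho).
Proof.
move=> z.
have c1 : continuous (fun z : 'rV[R]_n.+1 =>
    `|z ord0 ord0 - Num.sqrt (t0 ^+ 2 - tail_sqr z)|).
  have c0 : continuous (fun z : 'rV[R]_n.+1 =>
      z ord0 ord0 - Num.sqrt (t0 ^+ 2 - tail_sqr z)).
    move=> x; exact: (continuousB (@coord_continuous R _ _ ord0 ord0 x)
      (continuous_comp (@continuous_tail_sqr _ _ x)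
        (@continuous_sqrt_sub R (t0 ^+ 2) _))).
  by move=> x; exact: (continuous_comp (c0 x) (@norm_continuous _ R^o _)).
have cc (f : 'rV[R]_n.+1 -> R) a : continuous f ->
    continuous (fun x => cutoff (f x / a)).
  move=> cf x; have cfa := continuousM (cf x) (@cst_continuous _ _ a^-1 x).
  exact: (continuous_comp cfa (@continuous_cutoff R _)).
exact: (continuousM (cc _ _ c1 z) (cc _ _ (@continuous_tail_sqr R n) z)).
Qed.

Lemma knapp_ge0_le1 (R : realType) n (t0 delta rho : R) (z : 'rV[R]_n.+1) :
  0 <= knapp t0 delta rho z <= 1.
Proof.
rewrite /knapp; set a := _ / delta; set b := _ / rho ^+ 2.
have /andP[a0 a1] := cutoff_ge0_le1 a; have /andP[b0 b1] := cutoff_ge0_le1 b.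
by rewrite mulr_ge0//= mulr_ile1.
Qed.

Lemma knapp_eq0 (R : realType) n (t0 delta rho : R) (z : 'rV[R]_n.+1) :
  0 < delta -> 0 < rho ->
  ~ plate n (fun s => Num.sqrt (t0 ^+ 2 - s)) (2 * delta) (2 * rho) z ->
  knapp t0 delta rho z = 0.
Proof.
move=> d0 r0; apply: contra_notP => /eqP; rewrite mulf_eq0 negb_or => /andP[z1 z2].
split.
  rewrite leNgt; apply: contra z1 => h; apply/eqP/cutoff0.
  by rewrite ler_pdivlMr// ltW.
move=> i; rewrite leNgt; apply: contra z2 => h; apply/eqP/cutoff0.
rewrite ler_pdivlMr ?exprn_gt0//.
apply: (@le_trans _ _ (z ord0 (lift ord0 i) ^+ 2)).
  rewrite -[leRHS]real_normK ?num_real//; nra.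
by rewrite /tail_sqr (bigD1 i)//= lerDl sumr_ge0// => j _; exact: sqr_ge0.
Qed.

(** The points of the sphere with centre x and radius t at which f equals 1 contain a cap of width
    comparable to rho. The tolerance delta in the first coordinate is split into delta/4 for the
    position of x_1 and 3 delta/4 for the curvature error of [sqrt_sub_bound]. *)
Lemma knapp_mean_ge (R : realType) n : exists2 c : R, 0 < c &
  forall (x : 'rV[R]_n.+1) (t t0 delta rho X r : R),
  1 <= t <= 2 -> 1 <= t0 <= 2 -> `|t - t0| <= r ->
  0 <= X -> (forall i, `|x ord0 (lift ord0 i)| <= X) -> n.+1%:R * X <= 8^-1 ->
  0 < rho <= 8^-1 -> 0 < delta ->
  3 * (n.+1%:R * X) * rho + 8 * rho ^+ 2 * r <= 3 * delta / 4 ->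
  `|x ord0 ord0 - (t0 - Num.sqrt (t ^+ 2 - tail_sqr x))| <= delta / 4 ->
  ((c * rho ^+ n)%:E <=
    sphere_measure [set y | 1 <= knapp t0 delta rho (x - t *: y)]%R)%E.
Proof.
have [c c0 cap] := sphere_measure_cap_ge R n.
set D : R := n.+1%:R.
have D1 : 1 <= D by rewrite ler1n.
exists (c / (6 * D ^+ 2) ^+ n).
  by rewrite divr_gt0// exprn_gt0// mulr_gt0// exprn_gt0//; lra.
move=> x t t0 delta rho X r t12 t012 tr X0 xX X8 /andP[rho0 rho8] d0 small xt.
(* Chosen so that the bound 6Dk of [plate_hit] equals rho / D, which makes |z'| at most rho. *)
pose k := rho / (6 * D ^+ 2).
have D20 : 0 < 6 * D ^+ 2 by rewrite mulr_gt0// exprn_gt0//; lra.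
rewrite (_ : c / _ * _ = c * k ^+ n); last first.
  by rewrite /k expr_div_n; ring.
have k0 : 0 < k by rewrite divr_gt0.
apply: (cap _ (\row_i (x ord0 (lift ord0 i) / Num.sqrt (t ^+ 2 - tail_sqr x)))) => //.
  exact: (measurable_translate_ge _ _ _ (@continuous_knapp R n t0 delta rho)).
move=> z z0 zb.
have xD i : `|x ord0 (lift ord0 i)| <= (8 * D)^-1.
  apply: (le_trans (xX i)); rewrite invfM ler_pdivlMr; lra.
have kD : k <= D^-1.
  rewrite ler_pdivrMr// expr2 mulrCA mulKf ?gt_eqF//; lra.
have [] := @plate_hit R n x z t k t12 xD kD z0.
  by move=> i; have := zb i; rewrite mxE.
set z' := x - t *: direction z => z'k z'0 ez; split => //=.
rewrite -/z' /knapp.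
have z'r i : `|z' ord0 (lift ord0 i)| <= rho / D.
  apply: (le_trans (z'k i)); rewrite -/D /k le_eqVlt; apply/orP; left.
  by apply/eqP; field; lra.
have rD0 : 0 <= rho / D by rewrite divr_ge0//; lra.
have nD : n%:R <= D by rewrite ler_nat.
have n0 : 0 <= n%:R :> R by [].
have tz : tail_sqr z' <= rho ^+ 2.
  apply: (@le_trans _ _ (\sum_(i < n) (rho / D) ^+ 2)).
    by apply: ler_sum => i _; rewrite -[leLHS]real_normK ?num_real// ler_pXn2r ?nnegrE.
  rewrite sumr_const card_ord -[leLHS]mulr_natl exprMn exprVn mulrCA.
  rewrite ler_piMr ?sqr_ge0// ler_pdivrMr; nra.
have cz : `|\sum_i x ord0 (lift ord0 i) * z' ord0 (lift ord0 i)| <= D * X * rho.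
  apply: (le_trans (ler_norm_sum _ _ _)).
  apply: (@le_trans _ _ (\sum_(i < n) X * (rho / D))).
    by apply: ler_sum => i _; rewrite normrM ler_pM.
  rewrite sumr_const card_ord -[leLHS]mulr_natl [leLHS]mulrA.
  rewrite (_ : D * X * rho = D * X * (D * (rho / D))); last by field; lra.
  rewrite [leRHS]mulrA; apply: ler_wpM2r => //; rewrite -[leLHS]mulr1.
  by apply: ler_pM; rewrite ?mulr_ge0// ler_wpM2r.
have ax : 0 <= tail_sqr x <= (D * X) ^+ 2.
  rewrite tail_sqr_ge0/=; apply: (@le_trans _ _ (\sum_(i < n) X ^+ 2)).
    by apply: ler_sum => i _; rewrite -[leLHS]real_normK ?num_real// ler_pXn2r ?nnegrE.
  rewrite sumr_const card_ord -[leLHS]mulr_natl exprMn.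
  apply: ler_wpM2r; first exact: sqr_ge0.
  by apply: (le_trans nD); rewrite expr2 ler_peMl; lra.
have bz : 0 <= tail_sqr z' <= rho ^+ 2 by rewrite tail_sqr_ge0.
have DX4 : 0 <= D * X <= 4^-1 by rewrite mulr_ge0//=; lra.
have r4 : 0 <= rho <= 4^-1 by apply/andP; split; lra.
have H := sqrt_sub_bound t12 t012 tr ax bz cz DX4 r4.
rewrite !cutoff1 ?mulr1//.
  by rewrite ler_pdivrMr ?exprn_gt0// mul1r.
rewrite ler_pdivrMr// mul1r z'0.
have := le_trans (ler_normD _ _) (lerD xt (le_trans H small)).
rewrite [X in `|X| <= _](_ : _ = x ord0 ord0 + Num.sqrt (t ^+ 2 - (tail_sqr x -
  2 * (\sum_i x ord0 (lift ord0 i) * z' ord0 (lift ord0 i)) + tail_sqr z')) -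
  Num.sqrt (t0 ^+ 2 - tail_sqr z')); last by ring.
by move=> /le_trans; apply; lra.
Qed.

(** * Separated radii and disjoint plates *)

(** Greedy choice: if every point of A were within delta/2 of the m points already chosen, the
    intervals of length delta centred at these would cover A. *)
Lemma separated_points (R : realType) (A : set R) (delta : R) (m : nat) :
  0 < delta -> (m%:R%:E <= covering_number A delta)%E ->
  exists t : nat -> R, (forall i, (i < m)%N -> A (t i)) /\
    forall i j, (i < m)%N -> (j < m)%N -> i != j -> delta / 2 < `|t i - t j|.
Proof.
move=> d0; elim: m => [|m IH] mN.
  by exists (fun=> 0); split => // i j; rewrite ltn0.
have [|t [tA tsep]] := IH.
  by apply: le_trans mN; rewrite lee_fin ler_nat.
have [e [Ae te]] : exists e, A e /\ forall i, (i < m)%N -> delta / 2 < `|t i - e|.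
  apply/not_existsP => h.
  have : (covering_number A delta <= m%:R%:E)%E.
    apply: ereal_inf_lbound; exists m => //; exists (fun i => t i - delta / 2).
    move=> e Ae; have := h e; move/not_andP => [//|/existsNP[i /not_implyP[im]]].
    move=> /negP; rewrite -leNgt => ie; exists (Ordinal im) => //=.
    move: ie; rewrite in_itv/= ler_norml => /andP[h1 h2]; apply/andP; split; lra.
  move=> /(le_trans mN); rewrite lee_fin ler_nat ltnn//.
exists (fun i => if i == m then e else t i); split.
  by move=> i im; case: eqP => // /eqP im'; apply: tA; rewrite ltn_neqAle im' -ltnS.
move=> i j im jm ij; case: (eqVneq i m) => [iE|im']; case: (eqVneq j m) => [jE|jm'].
- by move: ij; rewrite iE jE eqxx.
- by rewrite distrC; apply: te; rewrite ltn_neqAle jm' -ltnS.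
- by apply: te; rewrite ltn_neqAle im' -ltnS.
- by apply: tsep => //; rewrite ltn_neqAle ?im' ?jm' -ltnS.
Qed.

(** A common point would give |si - sj| <= delta/2, where si = sqrt(ti^2 - |x'|^2). But (si - sj)(si
    + sj) = (ti - tj)(ti + tj) and si <= ti, sj <= tj, so |si - sj| is at least |ti - tj|. *)
Lemma trivIset_plates (R : realType) n m (t : nat -> R) (t0 delta X : R) :
  (forall i, (i < m)%N -> 1 <= t i) ->
  (forall i j, (i < m)%N -> (j < m)%N -> i != j -> delta / 2 < `|t i - t j|) ->
  n%:R * X ^+ 2 <= 4^-1 ->
  trivIset setT (fun i : 'I_m =>
    plate n (fun s => t0 - Num.sqrt (t i ^+ 2 - s)) (delta / 4) X).
Proof.
move=> t1 tsep nX; apply/trivIsetP => i j _ _ ij.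
rewrite -subset0 => x /= [[xi xX] [xj _]].
have a0 := tail_sqr_ge0 x; set a := tail_sqr x in a0 xi xj.
have a4 : a <= 4^-1.
  apply: le_trans nX; apply: (@le_trans _ _ (\sum_(i < n) X ^+ 2)).
    apply: ler_sum => k _; rewrite -[leLHS]real_normK ?num_real// ler_pXn2r ?nnegrE//.
    by apply: le_trans (xX k).
  by rewrite sumr_const card_ord -[leLHS]mulr_natl.
have ti1 := t1 i (ltn_ord i); have tj1 := t1 j (ltn_ord j).
have := tsep i j (ltn_ord i) (ltn_ord j) ij.
set ti := t i in ti1 xi *; set tj := t j in tj1 xj *.
set si := Num.sqrt (ti ^+ 2 - a) in xi; set sj := Num.sqrt (tj ^+ 2 - a) in xj.
have siE : si ^+ 2 = ti ^+ 2 - a by rewrite sqr_sqrtr//; nra.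
have sjE : sj ^+ 2 = tj ^+ 2 - a by rewrite sqr_sqrtr//; nra.
have si0 : 0 <= si by exact: sqrtr_ge0.
have sj0 : 0 <= sj by exact: sqrtr_ge0.
have siti : si <= ti by nra.
have sjtj : sj <= tj by nra.
have si2 : 2^-1 <= si by nra.
have sj2 : 2^-1 <= sj by nra.
have H : (si - sj) * (si + sj) = (ti - tj) * (ti + tj).
  by rewrite -!subr_sqr siE sjE; ring.
have H2 : `|ti - tj| <= `|si - sj|.
  have p0 : 0 < ti + tj by lra.
  rewrite -(ler_pM2r p0) -[in leLHS](gtr0_norm p0) -normrM -H normrM.
  by apply: ler_wpM2l => //; rewrite ger0_norm; lra.
have H3 : `|si - sj| <= delta / 2.
  have -> : si - sj = (x ord0 ord0 - (t0 - si)) - (x ord0 ord0 - (t0 - sj)) by ring.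
  by apply: (le_trans (ler_normB _ _)); lra.
by move=> /lt_le_trans /(_ (le_trans H2 H3)); rewrite ltxx.
Qed.

(** * The Knapp estimate *)

(** One bump is tested against all radii of a delta/2-separated subset of A. The covering number
    enters through any positive integer m below it, since it could a priori be infinite. *)
Lemma knapp_estimate (R : realType) n (E : set R) (p q : \bar R) (K h : R) :
  let x := fine p^-1%E in let y := fine q^-1%E in
  let s := h * n%:R * (1 - x - y) + n.+1%:R * y - x in
  E `<=` `[1, 2]%classic -> (1 <= p)%E -> (1 <= q)%E ->
  (spherical_maximal_norm n.+1 E p q <= K%:E)%E -> 0 <= h <= 1 ->
  exists2 C : R, 0 <= C & forall (delta : R) (A : set R) (m : nat),
    0 < delta < 1 -> A `<=` E ->
    (forall t t', A t -> A t' -> `|t - t'| <= delta `^ (1 - 2 * h)) ->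
    (0 < m)%N -> (m%:R%:E <= covering_number A delta)%E ->
    m%:R `^ y <= C * delta `^ (- s).
Proof.
move=> x y s E12 p1 q1 normK /andP[h0 h1].
have [c0 c00 mean] := knapp_mean_ge R n.
set D : R := n.+1%:R in mean.
have D1 : 1 <= D by rewrite ler1n.
(* Small enough for D X and rho to be at most 1/8 and for the curvature error to be at most 3
   delta/4. *)
pose c := 8^-1 / D.
have cD : (D * c = 8^-1)%R by rewrite /c; field; rewrite gt_eqF//; lra.
have c_gt0 : 0 < c by rewrite divr_gt0//; lra.
have c8 : c <= 8^-1 by nra.
pose c1 := c0 * c ^+ n * (2^-1 * (2 * c) ^+ n) `^ y.
pose c2 := (4 * (4 * c) ^+ n) `^ x.
have c1_gt0 : 0 < c1.
  rewrite /c1 mulr_gt0//; first by rewrite mulr_gt0// exprn_gt0.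
  by rewrite powR_gt0// mulr_gt0 ?invr_gt0// exprn_gt0// mulr_gt0.
have c2_gt0 : 0 < c2 by rewrite powR_gt0// mulr_gt0// exprn_gt0// mulr_gt0.
(* The absolute value keeps the constant nonnegative whatever the sign of K. *)
exists (`|K| * c2 / c1) => [|delta A m /andP[d0 d1] AE Ar m0 mN].
  apply: divr_ge0; last exact: ltW.
  by apply: mulr_ge0; [exact: normr_ge0|exact: ltW].
have [t [tA tsep]] := separated_points d0 mN.
have tE i : (i < m)%N -> 1 <= t i <= 2.
  by move=> /tA /AE /E12; rewrite /= in_itv.
pose rho := c * delta `^ h; pose X := c * delta `^ (1 - h).
have dh0 : 0 < delta `^ h by rewrite powR_gt0.
have dh1 : 0 < delta `^ (1 - h) by rewrite powR_gt0.
have pow_le1 e : 0 <= e -> delta `^ e <= 1.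
  move=> e0; have := @ge0_ler_powR R e e0 delta 1.
  by rewrite powR1 !nnegrE; apply => //; exact: ltW.
have rho0 : 0 < rho by rewrite mulr_gt0.
have X0 : 0 < X by rewrite mulr_gt0.
have rho8 : rho <= 8^-1 by have := pow_le1 _ h0; rewrite /rho; nra.
have X8 : D * X <= 8^-1.
  by rewrite /X mulrA cD ler_piMr// pow_le1// subr_ge0.
have Xrho : X * rho = c ^+ 2 * delta.
  rewrite /X /rho mulrACA -powRD; last by apply/implyP => _; rewrite gt_eqF.
  by rewrite subrK powRr1 ?ltW.
(* The exponent 1 - 2h in the diameter bound is the one for which rho^2 times the diameter is of
   order delta. *)
have rhor : rho ^+ 2 * delta `^ (1 - 2 * h) = c ^+ 2 * delta.
  rewrite /rho exprMn -mulrA -[(delta `^ h) ^+ 2]powR_mulrn ?(ltW dh0)//.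
  rewrite -powRrM -powRD; last by apply/implyP => _; rewrite gt_eqF.
  by rewrite (_ : h * 2 + _ = 1) ?powRr1 ?ltW//; ring.
have small : 3 * (D * X) * rho + 8 * rho ^+ 2 * delta `^ (1 - 2 * h) <= 3 * delta / 4.
  rewrite (_ : 3 * (D * X) * rho = 3 * (D * (X * rho))); last by ring.
  rewrite -(mulrA 8) rhor Xrho.
  have -> : D * (c ^+ 2 * delta) = 8^-1 * (c * delta) by rewrite -cD; ring.
  have : c * delta <= 8^-1 * delta by rewrite ler_wpM2r// ltW.
  have : c ^+ 2 * delta <= 8^-1 * (8^-1 * delta).
    rewrite expr2 -mulrA; apply: ler_pM => //; first exact: ltW.
      by rewrite mulr_ge0// ltW.
    by rewrite ler_wpM2r// ltW.
  lra.
have nX : n%:R * X ^+ 2 <= 4^-1.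
  have : n%:R <= D by rewrite ler_nat.
  have : 0 <= n%:R :> R by [].
  nra.
(* All plates refer to the same radius [t 0], that of the bump. *)
pose F (i : nat) := plate n (fun s => t 0 - Num.sqrt (t i ^+ 2 - s)) (delta / 4) X.
have cu t0 : continuous (fun s : R => t 0 - Num.sqrt (t0 ^+ 2 - s)).
  move=> u; exact: (continuousB (@cst_continuous _ _ (t 0 : R^o) u)
    (@continuous_sqrt_sub R (t0 ^+ 2) u)).
have d4 : 0 < delta / 4 by rewrite divr_gt0.
pose w := m%:R * (2 * (delta / 4) * (2 * X) ^+ n).
have mF i : measurable (F i) by exact: measurable_plate.
have leF : lebesgue_row R n.+1 (\big[setU/set0]_(i < m) F i) = w%:E.
  rewrite (@measure_bigsetU_ord _ _ _ (lebesgue_row R n.+1) m predT (fun i => F i))//; last first.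
    by apply: trivIset_plates => // i /tE /andP[].
  rewrite (eq_bigr (fun=> (2 * (delta / 4) * (2 * X) ^+ n)%:E)) => [|i _]; last first.
    exact: lebesgue_row_plate.
  by rewrite sumEFin sumr_const card_ord -[X in X%:E]mulr_natl.
have w0 : 0 < w by rewrite !mulr_gt0 ?ltr0n// exprn_gt0// mulr_gt0.
pose S := plate n (fun s => Num.sqrt (t 0 ^+ 2 - s)) (2 * delta) (2 * rho).
pose v := 2 * (2 * delta) * (2 * (2 * rho)) ^+ n.
have leS : lebesgue_row R n.+1 S = v%:E.
  by apply: (lebesgue_row_plate _ (@continuous_sqrt_sub R _)); rewrite mulr_gt0.
have v0 : 0 < v.
  apply: mulr_gt0; first by apply: mulr_gt0 => //; exact: mulr_gt0.
  by apply: exprn_gt0; apply: mulr_gt0 => //; exact: mulr_gt0.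
have mS : measurable S by exact: (@measurable_plate R n _ _ _ (@continuous_sqrt_sub R (t 0 ^+ 2))).
have fS z : ~ S z -> knapp (t 0) delta rho z = 0 by exact: knapp_eq0.
have mU : measurable (\big[setU/set0]_(i < m) F i).
  by apply: bigsetU_measurable => i _; exact: mF.
have cr0 : 0 < c0 * rho ^+ n by rewrite mulr_gt0// exprn_gt0.
have hit (z : 'rV[R]_n.+1) : (\big[setU/set0]_(i < m) F i) z ->
    exists2 t', E t' & ((c0 * rho ^+ n)%:E <=
      sphere_measure [set y | 1 <= knapp (t 0) delta rho (z - t' *: y)]%R)%E.
  rewrite -bigcup_mkord => -[i /= im [z0 zX]]; exists (t i); first exact/AE/tA.
  apply: (mean z (t i) (t 0) delta rho X (delta `^ (1 - 2 * h))) => //.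
  - exact: tE.
  - exact: tE.
  - by apply: Ar; exact: tA.
  - exact: ltW.
  - by rewrite rho0.
have leSv : (lebesgue_row R n.+1 S <= v%:E)%E by rewrite leS.
have leFw : (w%:E <= lebesgue_row R n.+1 (\big[setU/set0]_(i < m) F i))%E by rewrite leF.
have := spherical_test p1 q1 normK (@continuous_knapp R n (t 0) delta rho)
  (@knapp_ge0_le1 R n (t 0) delta rho) mS fS v0 leSv mU w0 leFw cr0 hit.
rewrite -/x -/y => test.
have d_neq0 : delta != 0 by rewrite gt_eqF.
have powD a b : delta `^ (a + b) = delta `^ a * delta `^ b.
  by rewrite powRD// d_neq0 implybT.
have powX a : (delta `^ a) ^+ n = delta `^ (a * n%:R).
  by rewrite powRrM powR_mulrn// powR_ge0.
have rhoE : rho ^+ n = c ^+ n * delta `^ (h * n%:R) by rewrite exprMn powX.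
have wE : w = m%:R * (2^-1 * (2 * c) ^+ n) * delta `^ (1 + (1 - h) * n%:R).
  rewrite /w /X (powD 1 ((1 - h) * n%:R)) powRr1 ?(ltW d0)// -powX !exprMn.
  by rewrite (_ : 2 * (delta / 4) = 2^-1 * delta); [ring|field].
have vE : v = 4 * (4 * c) ^+ n * delta `^ (1 + h * n%:R).
  rewrite /v /rho (powD 1 (h * n%:R)) powRr1 ?(ltW d0)// -powX.
  rewrite (_ : 2 * (2 * (c * delta `^ h)) = 4 * c * delta `^ h); last by ring.
  by rewrite !exprMn; ring.
(* The power of delta in rho^n w^y, where the factor m^y is left apart; that of v^x is (1 + hn) x =
   e - s. *)
pose e := h * n%:R + (1 + (1 - h) * n%:R) * y.
have : c1 * (m%:R `^ y * delta `^ e) <= `|K| * c2 * delta `^ ((1 + h * n%:R) * x).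
  have cc0 : 0 <= 2^-1 * (2 * c) ^+ n.
    by rewrite mulr_ge0// exprn_ge0// mulr_ge0// ltW.
  have cc1 : 0 <= 4 * (4 * c) ^+ n.
    by rewrite mulr_ge0// exprn_ge0// mulr_ge0// ltW.
  rewrite (_ : c1 * _ = c0 * rho ^+ n * w `^ y).
    apply: (le_trans test); rewrite vE powRM ?powR_ge0// -powRrM -/c2 mulrA.
    by rewrite ler_wpM2r ?powR_ge0// ler_wpM2r ?(ltW c2_gt0)// ler_norm.
  have -> : w `^ y = m%:R `^ y * (2^-1 * (2 * c) ^+ n) `^ y *
      delta `^ ((1 + (1 - h) * n%:R) * y).
    rewrite wE powRrM -powRM//; apply: powRM; last exact: powR_ge0.
    by apply: mulr_ge0.
  by rewrite /e powD rhoE /c1; ring.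
have de0 : 0 < delta `^ e by rewrite powR_gt0.
rewrite (_ : (1 + h * n%:R) * x = - s + e); last first.
  rewrite /s /e -natr1; ring.
rewrite (powD (- s) e) (mulrA c1) (mulrA (`|K| * c2)) ler_pM2r// => est.
by rewrite mulrAC ler_pdivlMr// [leLHS]mulrC.
Qed.

(** * Limits in a small parameter, and the large ball *)

(** For s < 0 the right-hand side would tend to 0 with delta. *)
Lemma powR_ge1_exponent (R : realType) (C s d0 : R) : 0 < d0 ->
  (forall delta, 0 < delta < d0 -> 1 <= C * delta `^ (- s)) -> 0 <= s.
Proof.
move=> d00 H; rewrite leNgt; apply/negP => s0.
(* Once delta^(-s) is at most b, the product with |C| is at most 1/2. *)
pose b := (2 * (`|C| + 1))^-1.
have C1 : 0 < `|C| + 1 by rewrite ltr_pwDr.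
have b0 : 0 < b by rewrite invr_gt0 mulr_gt0.
pose delta := Num.min (d0 / 2) (b `^ ((- s)^-1)).
have e0 : 0 < - s by rewrite oppr_gt0.
have de0 : 0 < delta by rewrite lt_min divr_gt0//= powR_gt0.
have : delta `^ (- s) <= b.
  have -> : b = (b `^ ((- s)^-1)) `^ (- s).
    by rewrite -powRrM mulVf ?gt_eqF// powRr1// ltW.
  rewrite ge0_ler_powR ?nnegrE ?powR_ge0 ?(ltW e0) ?(ltW de0)//.
  by rewrite ge_min lexx orbT.
have /H : 0 < delta < d0.
  rewrite de0/= (@le_lt_trans _ _ (d0 / 2))//; first by rewrite ge_min lexx.
  by rewrite ltr_pdivrMr// ltr_pMr// ltr1n.
move=> h1 h2; have := le_trans h1 (ler_wpM2r (powR_ge0 _ _) (ler_norm C)).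
have := ler_wpM2l (normr_ge0 C) h2.
move=> h3 /le_trans/(_ h3); rewrite /b invfM => h4.
have h5 : `|C| / (`|C| + 1) <= 1 by rewrite ler_pdivrMr// mul1r lerDl.
lra.
Qed.

Lemma continuous_sum_sqr (R : realType) n :
  continuous (fun x : 'rV[R]_n.+1 => \sum_i x ord0 i ^+ 2).
Proof.
apply: continuous_big => [|i _]; first exact: add_continuous.
move=> x.
exact: (continuous_comp (@coord_continuous R _ _ ord0 i x) (@exprn_continuous R 2 _)).
Qed.

(** With f = 1 on the ball of radius L, the means equal 1 on a cube of side comparable to L, so
    L^(D(y - x)) stays bounded. Writing L = 4D/delta turns L to infinity into delta to 0. *)
Lemma large_ball (R : realType) n (E : set R) (p q : \bar R) (K : R) :
  E `<=` `[1, 2]%classic -> E !=set0 -> (1 <= p)%E -> (1 <= q)%E ->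
  (spherical_maximal_norm n.+1 E p q <= K%:E)%E ->
  fine q^-1%E <= fine p^-1%E.
Proof.
move=> E12 [t Et] p1 q1 normK; set x := fine p^-1%E; set y := fine q^-1%E.
have /andP[t1 t2] : 1 <= t <= 2 by have := E12 _ Et; rewrite /= in_itv.
set D : R := n.+1%:R.
have D1 : 1 <= D by rewrite ler1n.
suff : 0 <= D * (x - y) by rewrite pmulr_rge0 ?subr_ge0//; lra.
apply: (@powR_ge1_exponent _ (K * (16 * D) `^ (D * x) / 4 `^ (D * y)) _ 1) => //.
move=> delta /andP[d0 d1].
pose L := 4 * D / delta.
have L4 : 4 * D <= L.
  by rewrite ler_pdivlMr// ler_piMr ?(ltW d1)// mulr_ge0//; lra.
have L0 : 0 < L by lra.
pose f (z : 'rV[R]_n.+1) := cutoff ((\sum_i z ord0 i ^+ 2) / L ^+ 2).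
have cf : continuous f.
  move=> z; have c1 := continuousM (@continuous_sum_sqr R n z) (@cst_continuous _ _ (L ^+ 2)^-1 z).
  exact: (continuous_comp c1 (@continuous_cutoff R _)).
have f01 z : 0 <= f z <= 1 by exact: cutoff_ge0_le1.
pose S : set 'rV[R]_n.+1 :=
  [set v | forall i, `|v ord0 i - (0 : 'rV[R]_n.+1) ord0 i| <= 2 * L].
pose A : set 'rV[R]_n.+1 :=
  [set v | forall i, `|v ord0 i - (0 : 'rV[R]_n.+1) ord0 i| <= L / (2 * D)].
have fS z : ~ S z -> f z = 0.
  apply: contra_notP => /eqP fz i; rewrite mxE subr0 leNgt; apply: contra fz => h.
  apply/eqP/cutoff0; rewrite ler_pdivlMr ?exprn_gt0//.
  apply: (@le_trans _ _ (z ord0 i ^+ 2)).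
    rewrite -[leRHS]real_normK ?num_real//; nra.
  by rewrite (bigD1 i)//= lerDl sumr_ge0// => j _; exact: sqr_ge0.
pose v := (2 * (2 * L)) ^+ n.+1; pose w := (2 * (L / (2 * D))) ^+ n.+1.
have L20 : 0 < 2 * L by rewrite mulr_gt0.
have LD0 : 0 < L / (2 * D) by rewrite divr_gt0// mulr_gt0//; lra.
have v0 : 0 < v by rewrite exprn_gt0// mulr_gt0.
have w0 : 0 < w by rewrite exprn_gt0// mulr_gt0.
have Sv : (lebesgue_row R n.+1 S <= v%:E)%E by rewrite lebesgue_row_cube.
have wA : (w%:E <= lebesgue_row R n.+1 A)%E by rewrite lebesgue_row_cube.
have hit z : A z -> exists2 t', E t' &
    (1%:E <= sphere_measure [set y | 1 <= f (z - t' *: y)]%R)%E.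
  (* The whole unit sphere lies in the set, so its total mass 1 is the lower bound. *)
  move=> Az; exists t => //; rewrite -(@sphere_measure_sphere R n.+1)//.
  apply: le_measure.
  - rewrite inE (_ : mkset _ = setT `&` enorm @^-1` [set 1]); first exact: measurable_enorm.
    by rewrite setTI.
  - by rewrite inE; exact: measurable_translate_ge.
  move=> u /= u1; rewrite /f cutoff1// ler_pdivrMr ?exprn_gt0// mul1r.
  have u_le1 i : `|u ord0 i| <= 1.
    rewrite -u1 -sqrtr_sqr /enorm ler_wsqrtr// (bigD1 i)//= lerDl sumr_ge0// => j _.
    exact: sqr_ge0.
  apply: (@le_trans _ _ (\sum_(i < n.+1) (L / D) ^+ 2)).
    apply: ler_sum => i _; rewrite -[leLHS]real_normK ?num_real// ler_pXn2r ?nnegrE//; last first.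
      by rewrite divr_ge0//; lra.
    rewrite !mxE; apply: (le_trans (ler_normB _ _)).
    have := Az i; rewrite mxE subr0 normrM (ger0_norm (x := t)); last lra.
    have -> : L / D = L / (2 * D) + L / (2 * D) by field; rewrite gt_eqF//; lra.
    move=> zi; apply: lerD => //; apply: (@le_trans _ _ 2).
      by rewrite -[leRHS]mulr1 ler_pM//; lra.
    rewrite ler_pdivlMr; lra.
  rewrite sumr_const card_ord -[leLHS]mulr_natl -/D expr_div_n.
  rewrite (_ : D * _ = L ^+ 2 / D); last by field; rewrite gt_eqF//; lra.
  rewrite ler_pdivrMr; last lra.
  by rewrite ler_peMr// sqr_ge0.
have := spherical_test p1 q1 normK cf f01 (measurable_cube _ _) fS v0 Sv
  (measurable_cube _ _) w0 wA ltr01 hit.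
rewrite mul1r -/x -/y.
have -> : v = (16 * D / delta) ^+ n.+1 by rewrite /v /L; congr (_ ^+ _); ring.
have -> : w = (4 / delta) ^+ n.+1.
  rewrite /w /L; congr (_ ^+ _); field; rewrite !gt_eqF//; lra.
have pw b c : 0 < b -> ((b / delta) ^+ n.+1) `^ c = b `^ (D * c) * delta `^ (- (D * c)).
  move=> b0; have bd : 0 <= b / delta by rewrite divr_ge0// ltW.
  rewrite -(powR_mulrn n.+1 bd) -powRrM -/D powRM ?invr_ge0 ?(ltW b0) ?(ltW d0)//.
  by rewrite -[delta^-1]powR_inv1 ?(ltW d0)// -powRrM mulN1r.
rewrite !pw//; last by rewrite mulr_gt0//; lra.
have dy0 : 0 < delta `^ (- (D * y)) by rewrite powR_gt0.
have fy0 : 0 < 4 `^ (D * y) :> R by rewrite powR_gt0.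
rewrite (_ : - (D * (x - y)) = - (D * x) - - (D * y)); last by ring.
rewrite powRB; last by apply/implyP => _; rewrite gt_eqF.
move=> h; rewrite mulrA ler_pdivlMr// mul1r mulrAC ler_pdivlMr// mulrC -mulrA.
exact: h.
Qed.

(** * From covering numbers to dimensions *)

Lemma covering_number_ge1 (R : realType) (A : set R) (delta : R) :
  A !=set0 -> (1%:R%:E <= covering_number A delta)%E.
Proof.
move=> [e Ae]; apply: le_ereal_inf_tmp => _ [m [a Aa] <-].
rewrite lee_fin ler_nat; case: m a Aa => // a /(_ _ Ae) [[]]//.
Qed.

(** Otherwise every admissible number of intervals exceeds c, hence is at least floor(c) + 1, and
    this integer contradicts the hypothesis. An infinite covering number is thereby excluded too. *)
Lemma covering_number_le (R : realType) (A : set R) (delta c : R) : 0 <= c ->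
  (forall m, (0 < m)%N -> (m%:R%:E <= covering_number A delta)%E -> m%:R <= c) ->
  (covering_number A delta <= c%:E)%E.
Proof.
move=> c0 H; rewrite leNgt; apply/negP => cN.
have : (Num.truncn c).+1%:R <= c.
  apply: H => //; apply: le_ereal_inf_tmp => _ [m ma <-].
  have : (c%:E < m%:R%:E)%E.
    by apply: (lt_le_trans cN); apply: ereal_inf_lbound; exists m.
  rewrite lte_fin lee_fin ler_nat => cm.
  by rewrite truncn_lt_nat// ltW.
by rewrite leNgt truncnS_gt.
Qed.

(** A nonempty set needs at least one interval, so the bound cannot tend to 0. This is the lower
    bound that [inf] requires. *)
Lemma minkowski_admissible_ge0 (R : realType) (E : set R) (b : R) :
  E !=set0 ->
  (forall eps, 0 < eps -> exists C : R, forall delta, 0 < delta < 1 ->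
    (covering_number E delta <= (C * delta `^ (- b - eps))%:E)%E) ->
  0 <= b.
Proof.
move=> E0 Hb; apply/ler_addgt0Pr => eps eps0; have [C HC] := Hb eps eps0.
apply: (@powR_ge1_exponent _ C _ 1) => // delta d01.
rewrite opprD -lee_fin; apply: le_trans (HC delta d01).
exact: covering_number_ge1.
Qed.

Section Dimension.
Context (R : realType) (n : nat) (E : set R) (p q : \bar R) (K : R).
Hypotheses (E12 : E `<=` `[1, 2]%classic) (E0 : E !=set0).
Hypotheses (p1 : (1 <= p)%E) (q1 : (1 <= q)%E).
Hypothesis normK : (spherical_maximal_norm n.+1 E p q <= K%:E)%E.
Let x := fine p^-1%E.
Let y := fine q^-1%E.
Let s (h : R) := h * n%:R * (1 - x - y) + n.+1%:R * y - x.

Let y_ge0 : 0 <= y.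
Proof. by rewrite fine_ge0// inve_ge0 (le_trans _ q1). Qed.

(** The Knapp estimate for a single radius. It gives the edge Q1 Q4 at h = 0 and covers y = 0 below,
    where covering numbers give no information. *)
Lemma knapp_exponent_ge0 (h : R) : 0 <= h <= 1 -> 0 <= s h.
Proof.
move=> h01; have [C C0 H] := knapp_estimate E12 p1 q1 normK h01.
have [e Ee] := E0.
apply: (@powR_ge1_exponent _ C _ 1) => // delta d01.
have := H delta [set e] 1 d01; rewrite powR1; apply => //.
- by move=> _ ->.
- by move=> _ _ -> ->; rewrite subrr normr0 powR_ge0.
- by apply: covering_number_ge1; exists e.
Qed.

Lemma knapp_covering (h : R) : 0 <= h <= 1 -> 0 < y ->
  exists C : R, forall (delta : R) (A : set R), 0 < delta < 1 -> A `<=` E ->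
    (forall t t', A t -> A t' -> `|t - t'| <= delta `^ (1 - 2 * h)) ->
    (covering_number A delta <= (C * delta `^ (- (s h / y)))%:E)%E.
Proof.
move=> h01 y0; have [C C0 H] := knapp_estimate E12 p1 q1 normK h01.
exists (C `^ y^-1) => delta A d01 AE Ar.
apply: covering_number_le => [|m m0 mN]; first by rewrite mulr_ge0// powR_ge0.
have := H delta A m d01 AE Ar m0 mN; rewrite -/x -/y -/(s h) => est.
have yi : 0 <= y^-1 by rewrite invr_ge0.
have := ge0_ler_powR yi _ _ est; rewrite !nnegrE powR_ge0 mulr_ge0 ?powR_ge0//.
move=> /(_ isT isT); rewrite -powRrM mulfV ?gt_eqF// powRr1//.
by rewrite powRM ?powR_ge0// -powRrM mulNr.
Qed.

Let powR_le_exp (delta a b : R) : 0 < delta < 1 -> b <= a ->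
  delta `^ a <= delta `^ b.
Proof. by move=> /andP[d0 d1] ab; rewrite ger_powR// d0 ltW. Qed.

(** For h >= 1/2 the allowed diameter delta^(1 - 2h) is at least 1, so A = E is permitted and s(h)/y
    is an admissible exponent. *)
Lemma minkowski_exponent (h : R) : 2^-1 <= h <= 1 ->
  upper_minkowski_dim E * y <= s h.
Proof.
move=> /andP[h2 h1]; have h01 : 0 <= h <= 1 by apply/andP; split; lra.
have := y_ge0; rewrite le_eqVlt => /predU1P[<-|y0].
  by rewrite mulr0; exact: knapp_exponent_ge0.
rewrite -ler_pdivlMr//; apply: ge_inf.
  by exists 0 => b; exact: minkowski_admissible_ge0.
move=> eps eps0; have [C HC] := knapp_covering h01 y0.
exists `|C| => delta d01; apply: (le_trans (HC delta E d01 _ _)) => //.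
  move=> t t' /E12 + /E12; rewrite /= !in_itv/= => /andP[t1 t2] /andP[u1 u2].
  apply: (@le_trans _ _ (delta `^ 0)); last by apply: powR_le_exp => //; lra.
  by rewrite powRr0 ler_norml; apply/andP; split; lra.
rewrite lee_fin; apply: (@le_trans _ _ (`|C| * delta `^ (- (s h / y)))).
  by rewrite ler_wpM2r ?powR_ge0// ler_norm.
by rewrite ler_wpM2l//; apply: powR_le_exp => //; lra.
Qed.

(** With h = (1 - theta)/2 the allowed diameter is delta^theta, the length of the intervals of the
    spectrum. Since delta/|I| = delta^(1 - theta), an additional factor 1 - theta appears. *)
Lemma spectrum_exponent (theta : R) : 0 <= theta < 1 ->
  assouad_spectrum theta E * (1 - theta) * y <= s ((1 - theta) / 2).
Proof.
move=> /andP[th0 th1]; have h01 : 0 <= (1 - theta) / 2 <= 1 by apply/andP; split; lra.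
have := y_ge0; rewrite le_eqVlt => /predU1P[<-|y0].
  by rewrite mulr0; exact: knapp_exponent_ge0.
have th10 : 0 < 1 - theta by lra.
have scale (delta e : R) : 0 < delta ->
    (delta / delta `^ theta) `^ e = delta `^ ((1 - theta) * e).
  move=> d0; rewrite powRrM powRB ?powRr1 ?(ltW d0)//.
  by apply/implyP => _; rewrite gt_eqF.
rewrite -ler_pdivlMr// -ler_pdivlMr//; apply: ge_inf.
  exists 0 => g [d0 d00 Hg]; apply/ler_addgt0Pr => eps eps0.
  have [C HC] := Hg eps eps0; have [e Ee] := E0.
  suff : 0 <= (1 - theta) * (g + eps) by rewrite pmulr_rge0.
  apply: (@powR_ge1_exponent _ C _ d0) => // delta /[dup] d01 /andP[dgt0 _].
  (* The closed interval starting at a point e of E meets E, so its covering number is at least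
     1. *)
  have ab : e + delta `^ theta - e = delta `^ theta by ring.
  have := HC delta e (e + delta `^ theta) true false d01 ab.
  rewrite ab scale// -opprD mulrN -lee_fin; apply: le_trans.
  apply: covering_number_ge1; exists e; split => //=.
  by rewrite in_itv/= lexx lerDl powR_ge0.
exists 1 => // eps eps0; have [C HC] := knapp_covering h01 y0.
exists `|C| => delta a b ca cb d01 ab; have /andP[dgt0 _] := d01.
apply: (le_trans (HC delta _ d01 _ _)); first exact: subIsetl.
  have cl t : [set` Interval (BSide ca a) (BSide cb b)] t -> a <= t <= b.
    by case: ca; case: cb; rewrite /= in_itv/= => /andP[t1 t2]; apply/andP; split; lra.
  move=> t t' [_ /cl /andP[t1 t2]] [_ /cl /andP[u1 u2]].
  rewrite (_ : 1 - 2 * _ = theta); last by field.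
  by rewrite -ab ler_norml; apply/andP; split; lra.
rewrite ab scale// lee_fin.
apply: (@le_trans _ _ (`|C| * delta `^ (- (s ((1 - theta) / 2) / y)))).
  by rewrite ler_wpM2r ?powR_ge0// ler_norm.
rewrite ler_wpM2l//; apply: powR_le_exp => //.
rewrite mulrBr mulrN mulrC divfK ?gt_eqF//.
by rewrite gerBl mulr_ge0// ltW.
Qed.

End Dimension.

(** * Membership in the quadrangle *)

(** The third vertex is the origin, so only a + b <= 1 is asked: combine P and Q with weight a/(a +
    b), then the result with the origin. *)
Lemma convex_set_triangle (R : realType) (A : set (R^o * R^o))
    (P Q : R^o * R^o) (a b x y : R) :
  convex_set A -> A (0, 0) -> A P -> A Q -> 0 <= a -> 0 <= b -> a + b <= 1 ->
  x = a * P.1 + b * Q.1 -> y = a * P.2 + b * Q.2 -> A (x, y).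
Proof.
move=> cA A0 AP AQ a0 b0 ab1 -> ->.
have conv U V (l : R) : A U -> A V -> 0 <= l <= 1 ->
    A (l * U.1 + (1 - l) * V.1, l * U.2 + (1 - l) * V.2).
  move=> AU AV l01.
  have := cA U V (Itv01 (andP l01).1 (andP l01).2).
  by rewrite !inE => /(_ AU AV).
have [ab0|abn0] := eqVneq (a + b) 0.
  have -> : a = 0 by lra.
  have -> : b = 0 by lra.
  by rewrite !mul0r addr0.
have ab_gt0 : 0 < a + b by rewrite lt0r abn0 addr_ge0.
have l01 : 0 <= a / (a + b) <= 1.
  by rewrite divr_ge0 ?(ltW ab_gt0)//= ler_pdivrMr// mul1r lerDl.
have ab01 : 0 <= a + b <= 1 by rewrite ab1 ltW.
have := conv _ _ _ (conv _ _ _ AP AQ l01) A0 ab01.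
by rewrite /= !mulr0 !addr0; congr (A (_, _)); field.
Qed.

(** The inequalities are those of the edges Q1 Q2, Q1 Q4, Q2 Q3 and Q3 Q4. The diagonal Q1 Q3, x =
    (D - beta) y, cuts the quadrangle into two triangles with vertex at the origin. For beta = 0 the
    second one is degenerate, so the last inequality is asked only for beta > 0. *)
Lemma mem_quadrangle (R : realType) (d : nat) (beta gamma x y : R) :
  (2 <= d)%N -> 0 <= beta <= 1 -> 0 <= y -> y <= x ->
  x <= d%:R * y -> beta * y <= d%:R - 1 + y - d%:R * x ->
  (0 < beta -> 0 < gamma /\ beta * y <=
    beta / (2 * gamma) * (d%:R - 1) * (1 - x - y) + d%:R * y - x) ->
  quadrangle d beta gamma (x, y).
Proof.
move=> d2 /andP[be0 be1] y0 yx xdy ball kn.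
have : 2 <= d%:R :> R by rewrite ler_nat.
rewrite /quadrangle; set D : R := d%:R in xdy ball kn * => D2.
set Q1 := (0, 0); set Q2 := ((D - 1) / _, _); set Q3 := ((D - beta) / _, _).
set Q4 := (_, _) => A [[clA cA] QA].
have A1 : A Q1 by apply: QA; left; left; left.
have A2 : A Q2 by apply: QA; left; left; right.
have A3 : A Q3 by apply: QA; left; right.
have A4 : A Q4 by apply: QA; right.
have [xy|xy] := leP x ((D - beta) * y).
  (* This happens only for D = 2, beta = 1, when Q2 = Q3 and the triangle is a segment of the
     diagonal x = y. *)
  have [D1|D1] := eqVneq (D - beta - 1) 0.
    have xE : x = y.
      have -> : x = (D - beta) * y - ((D - beta) * y - x) by ring.
      have : (D - beta) * y = y by rewrite (_ : D - beta = 1) ?mul1r//; lra.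
      lra.
    pose a := y * (D - 1 + beta) / (D - 1).
    have a0 : 0 <= a by rewrite /a divr_ge0 ?mulr_ge0//; lra.
    apply: (@convex_set_triangle _ A Q2 Q2 a 0 _ _ cA A1 A2 A2) => //.
    - by rewrite addr0 /a ler_pdivrMr; [rewrite xE in ball; lra|lra].
    - by rewrite /Q2/= mul0r addr0 xE /a; field; apply/andP; split; lra.
    - by rewrite /Q2/= mul0r addr0 /a; field; apply/andP; split; lra.
  have D1p : 0 < D - beta - 1.
    by rewrite lt0r D1/=; lra.
  pose b := (x - y) * (D - beta + 1) / (D - beta - 1).
  pose a := ((D - beta) * y - x) * (D - 1 + beta) / ((D - 1) * (D - beta - 1)).
  have D11 : 0 < (D - 1) * (D - beta - 1) by rewrite mulr_gt0//; lra.
  apply: (@convex_set_triangle _ A Q2 Q3 a b _ _ cA A1 A2 A3).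
  - by rewrite /a divr_ge0 ?mulr_ge0 ?(ltW D11)//; lra.
  - by rewrite /b divr_ge0 ?mulr_ge0 ?(ltW D1p)//; lra.
  (* With the coordinates a, b of (x, y) along Q2 and Q3, the condition a + b <= 1 is the inequality
     of the edge Q2 Q3. *)
  - have -> : a + b = (D * x - (1 - beta) * y) / (D - 1).
      by rewrite /a /b; field; apply/andP; split; lra.
    by rewrite ler_pdivrMr; lra.
  - by rewrite /Q2 /Q3/= /a /b; field; do ?[apply/andP; split]; lra.
  - by rewrite /Q2 /Q3/= /a /b; field; do ?[apply/andP; split]; lra.
have be0' : 0 < beta.
  rewrite lt0r be0 andbT; apply/eqP => b0; rewrite b0 in xy.
  lra.
have [g0 kn'] := kn be0'.
have G0 : 0 < D ^+ 2 + 2 * gamma - 1 by nra.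
pose c := (x - (D - beta) * y) * (D ^+ 2 + 2 * gamma - 1) / ((D - 1) * beta).
pose b := (D * y - x) * (D - beta + 1) / beta.
have Db0 : 0 < (D - 1) * beta by rewrite mulr_gt0//; lra.
apply: (@convex_set_triangle _ A Q3 Q4 b c _ _ cA A1 A3 A4).
- by rewrite /b divr_ge0 ?mulr_ge0//; lra.
- by rewrite /c divr_ge0 ?mulr_ge0 ?(ltW Db0) ?(ltW G0)//; lra.
- rewrite -subr_ge0.
  (* The slack is a nonnegative multiple of the one in the inequality of the edge Q3 Q4. *)
  have -> : 1 - (b + c) = 2 * gamma / ((D - 1) * beta) *
      (beta / (2 * gamma) * (D - 1) * (1 - x - y) + D * y - x - beta * y).
    by rewrite /b /c; field; do ?[apply/andP; split]; lra.
  apply: mulr_ge0; last lra.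
  by rewrite divr_ge0 ?(ltW Db0)//; lra.
- by rewrite /Q3 /Q4/= /b /c; field; do ?[apply/andP; split]; lra.
- by rewrite /Q3 /Q4/= /b /c; field; do ?[apply/andP; split]; lra.
Qed.

Lemma upper_minkowski_dim_itv (R : realType) (E : set R) :
  E `<=` `[1, 2]%classic -> E !=set0 -> 0 <= upper_minkowski_dim E <= 1.
Proof.
move=> E12 E0; have lb0 b := @minkowski_admissible_ge0 _ E b E0.
have in1 eps : 0 < eps -> exists C : R, forall delta, 0 < delta < 1 ->
      (covering_number E delta <= (C * delta `^ (- 1 - eps))%:E)%E.
  move=> eps0; exists 2 => delta /andP[d0 d1].
  (* This many intervals of length delta, laid end to end from 1, cover [1, 2]. *)
  pose m := (Num.truncn (delta^-1)).+1.
  have di : 0 <= delta^-1 by rewrite invr_ge0 ltW.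
  have : (covering_number E delta <= m%:R%:E)%E.
    apply: ereal_inf_lbound; exists m => //; exists (fun i => 1 + i%:R * delta).
    move=> t /E12; rewrite /= in_itv/= => /andP[t1 t2].
    have tm : 0 <= (t - 1) / delta by rewrite divr_ge0 ?(ltW d0)// subr_ge0.
    have im : (Num.truncn ((t - 1) / delta) < m)%N.
      rewrite ltnS; apply: le_truncn; rewrite ler_pdivrMr// mulVf ?gt_eqF//; lra.
    exists (Ordinal im) => //=; rewrite in_itv/=; set k := Num.truncn _.
    have := truncn_itv tm; rewrite -/k -natr1 => /andP[].
    rewrite ler_pdivlMr// ltr_pdivrMr// => h1 h2; apply/andP; split; lra.
  move=> /le_trans; apply; rewrite lee_fin.
  apply: (@le_trans _ _ (2 * delta^-1)).
    rewrite /m -natr1; have /andP[h1 _] := truncn_itv di.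
    have : 1 <= delta^-1 by rewrite invf_ge1// ltW.
    lra.
  rewrite ler_wpM2l// -powR_inv1 ?(ltW d0)//.
  by rewrite ger_powR ?d0 ?(ltW d1)//; lra.
apply/andP; split; last by apply: ge_inf => //; exists 0 => b; exact: lb0.
by apply: lb_le_inf; [exists 1|move=> b; exact: lb0].
Qed.

(** * Unboundedness outside the three quadrangles *)

Theorem theorem2 (R : realType) (d : nat) (E : set R) (p q : \bar R)
    (hd : (2 <= d)%N) (hE : E `<=` `[1, 2]%classic) (E0 : E !=set0)
    (hp : (1 <= p)%E) (hq : (1 <= q)%E) :
  let beta := upper_minkowski_dim E in
  let pq : R^o * R^o := (fine p^-1%E, fine q^-1%E) in
  [/\ ~ quadrangle d beta beta pq -> spherical_maximal_norm d E p q = +oo%E,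
      forall theta : R, 0 <= theta < 1 ->
        assouad_spectrum theta E = beta / (1 - theta) ->
        ~ quadrangle d beta (beta / (1 - theta)) pq ->
        spherical_maximal_norm d E p q = +oo%E
    & forall beta0 gamma : R, 0 <= beta0 -> beta0 <= gamma -> gamma <= 1 ->
        assouad_regular beta0 gamma E ->
        ~ quadrangle d beta0 gamma pq ->
        spherical_maximal_norm d E p q = +oo%E].
Proof.
case: d hd => [//|n hn] beta pq.
have n1 : n%:R = n.+1%:R - 1 :> R by rewrite -natr1 addrK.
pose x := fine p^-1%E; pose y := fine q^-1%E.
have /andP[be0 be1] := upper_minkowski_dim_itv hE E0.
(* Contraposition: a value other than +oo is bounded by some real K. *)
have infinite g : (forall K : R,
    (spherical_maximal_norm n.+1 E p q <= K%:E)%E -> quadrangle n.+1 beta g pq) ->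
    ~ quadrangle n.+1 beta g pq -> spherical_maximal_norm n.+1 E p q = +oo%E.
  move=> H nQ; apply/eqP; apply: contra_notT nQ; rewrite -ltey.
  case: spherical_maximal_norm H => [r||] H //= _; first exact: (H r).
  by apply: (H 0); rewrite leNye.
have y0 : 0 <= y by rewrite fine_ge0// inve_ge0 (le_trans _ hq).
(* Three edges are common to all cases, from the large ball, h = 0 and h = 1; only Q3 Q4 is left to
   each case. *)
have mem K g : (spherical_maximal_norm n.+1 E p q <= K%:E)%E ->
    (0 < beta -> 0 < g /\ beta * y <= beta / (2 * g) * n%:R * (1 - x - y) +
      n.+1%:R * y - x) -> quadrangle n.+1 beta g pq.
  move=> normK; rewrite n1 => kn; apply: mem_quadrangle => //.
  - by rewrite be0.
  - exact: (large_ball hE E0 hp hq normK).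
  - have := knapp_exponent_ge0 hE E0 hp hq normK (h := 0).
    rewrite lexx ler01 -/x -/y => /(_ isT); lra.
  - have := minkowski_exponent hE E0 hp hq normK (h := 1).
    rewrite -/x -/y -/beta lexx invf_le1 ?ler1n// => /(_ isT); rewrite n1; lra.
split.
- apply: infinite => K normK; apply: (mem K) => // b0; split => //.
  have := minkowski_exponent hE E0 hp hq normK (h := 2^-1).
  rewrite -/x -/y -/beta lexx invf_le1 ?ler1n// => /(_ isT).
  by rewrite (_ : beta / (2 * beta) = 2^-1)//; field; rewrite gt_eqF.
- move=> th /[dup] th01 /andP[th0 th1] spE; apply: infinite => K normK.
  have th10 : 0 < 1 - th by rewrite subr_gt0.
  apply: (mem K) => // b0; split; first by rewrite divr_gt0.
  have := spectrum_exponent hE E0 hp hq normK th01.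
  rewrite spE divfK ?gt_eqF// -/x -/y.
  rewrite (_ : beta / (2 * (beta / (1 - th))) = (1 - th) / 2)//.
  by field; rewrite !gt_eqF.
- move=> b g b0 bg g1 [bE gE spE]; rewrite -bE -/beta; apply: infinite => K normK.
  apply: (mem K) => // b_gt0; rewrite -bE -/beta in bg b0 spE.
  have g0 : 0 < g by lra.
  split => //; set A := n%:R * (1 - x - y) / 2 - g * y.
  set B := n.+1%:R * y - x.
  pose u0 := beta / g.
  have u00 : 0 < u0 by rewrite divr_gt0.
  have u01 : u0 <= 1 by rewrite ler_pdivrMr// mul1r.
  (* Regularity gives the inequality at theta = 1 - u only for u strictly below u0 = beta/gamma; the
     edge Q3 Q4 is its limit at u0. *)
  have F u : 0 < u < u0 -> 0 <= u * A + B.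
    move=> /andP[u_gt0 uu0]; have th01 : 0 <= 1 - u < 1 by apply/andP; split; lra.
    have := spectrum_exponent hE E0 hp hq normK th01.
    rewrite spE; last by apply/andP; split; rewrite -/u0; lra.
    by rewrite gE subKr -/x -/y /A /B; lra.
  have B0 : 0 <= B.
    have := knapp_exponent_ge0 hE E0 hp hq normK (h := 0).
    by rewrite lexx ler01 -/x -/y => /(_ isT); rewrite /B; lra.
  suff : 0 <= u0 * A + B.
    rewrite (_ : u0 * A = beta / (2 * g) * n%:R * (1 - x - y) - beta * y); last first.
      by rewrite /u0 /A; field; rewrite gt_eqF.
    by rewrite /B; lra.
  rewrite leNgt; apply/negP => F0.
  have A0 : A < 0 by nra.
  (* An affine function nonnegative at 0 and negative at u0 has a root in [0, u0[; at the midpoint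
     between the root and u0 it is negative, against [F]. *)
  have r0 : 0 <= - B / A by rewrite mulNr -mulrN -invrN divr_ge0//; lra.
  have r1 : - B / A < u0 by rewrite ltr_ndivrMr//; lra.
  have : 0 < (- B / A + u0) / 2 < u0 by apply/andP; split; lra.
  move=> /F; rewrite (_ : _ * A + B = (u0 * A + B) / 2); first lra.
  by field; rewrite lt_eqF.
Qed.
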